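(* For a convex polyhedron $P\subset\mathbb R^3$, \[ \delta(P)=0\quad\Longleftrightarrow\quad F_P(-n_F)\text{ is a vertex for every facet }F\text{ of }P. \] Equivalently, $\delta(P)=0$ if and only if no facet of $P$ has an opposite support face $F_P(-n_F)$ which is an edge or a facet.
   Context: A convex polyhedron $P\subset\mathbb R^3$ means a compact full-dimensional convex polytope. Two points of $P$ are antipodal if there are two parallel supporting planes of $P$, one through each point, that contain $P$ between them. $V(P)$ is the number of vertices of $P$; $A(P)$ is the number of unordered pairs of distinct vertices of $P$ that are antipodal; $B(P)$ is the number of unordered pairs of distinct edges of $P$ whose midpoints are antipodal. The antipodal defect is $\delta(P)=V(P)-1-A(P)+B(P)$. For $u\in S^2$, $F_P(u)=\{x\in P:\langle u,x\rangle=\max_{y\in P}\langle u,y\rangle\}$ is the support face in direction $u$. For a facet $F$ of $P$, $n_F$ is its outward unit normal, and $F_P(-n_F)$ is its opposite support face. *)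

(* Defs.v *)
From mathcomp Require Import all_boot all_order all_algebra.
From mathcomp Require Import finmap.
From mathcomp Require Import boolp classical_sets functions cardinality reals.

Set Implicit Arguments.
Unset Strict Implicit.
Unset Printing Implicit Defensive.

Import Order.TTheory GRing.Theory Num.Theory.
Local Open Scope classical_set_scope.
Local Open Scope ring_scope.

Definition dot (R : realType) (u v : 'rV[R]_3) : R := \sum_i u 0 i * v 0 i.

Definition convex_hull (R : realType) (n : nat) (p : 'I_n -> 'rV[R]_3) :
    set 'rV[R]_3 :=
  [set x | exists w : 'I_n -> R,
    [/\ forall i, 0 <= w i, \sum_i w i = 1 & x = \sum_i w i *: p i]].

(* The rows of [A] are a basis, made of differences of points of [S], of the
   direction of the affine hull of [S]. *)
Definition has_affine_dim (R : realType) (S : set 'rV[R]_3) (d : nat) : Prop :=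
  exists (x0 : 'rV[R]_3) (A : 'M[R]_(d, 3)),
    [/\ S x0, row_free A, forall i, S (x0 + row i A)
      & forall x, S x -> (x - x0 <= A)%MS].

Definition convex_polyhedron (R : realType) (P : set 'rV[R]_3) : Prop :=
  (exists (n : nat) (p : 'I_n -> 'rV[R]_3), P = convex_hull p)
  /\ has_affine_dim P 3.

Definition support_face (R : realType) (P : set 'rV[R]_3) (u : 'rV[R]_3) :
    set 'rV[R]_3 :=
  [set x | P x /\ forall y, P y -> dot u y <= dot u x].

Definition is_face (R : realType) (d : nat) (P F : set 'rV[R]_3) : Prop :=
  (exists2 u : 'rV[R]_3, u != 0 & F = support_face P u) /\ has_affine_dim F d.

Definition is_vertex (R : realType) (P : set 'rV[R]_3) (v : 'rV[R]_3) : Prop :=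
  is_face 0 P [set v].

Definition is_edge (R : realType) (P E : set 'rV[R]_3) : Prop := is_face 1 P E.

Definition is_facet (R : realType) (P F : set 'rV[R]_3) : Prop := is_face 2 P F.

(* Normalized with [dot]: the library norm on ['rV[R]_3] is the sup norm. *)
Definition outward_unit_normal (R : realType) (P F : set 'rV[R]_3)
    (n : 'rV[R]_3) : Prop :=
  dot n n = 1 /\
  exists c : R, (forall x, F x -> dot n x = c) /\ (forall x, P x -> dot n x <= c).

Definition plane (R : realType) (u : 'rV[R]_3) (c : R) : set 'rV[R]_3 :=
  [set z | dot u z = c].

Definition antipodal (R : realType) (P : set 'rV[R]_3) (x y : 'rV[R]_3) : Prop :=
  [/\ P x, P y &
    exists (u : 'rV[R]_3) (a b : R),
      [/\ u != 0, plane u a x, plane u b y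
        & forall z, P z -> b <= dot u z <= a]].

Definition segment (R : realType) (a b : 'rV[R]_3) : set 'rV[R]_3 :=
  [set x | exists2 t : R, 0 <= t <= 1 & x = (1 - t) *: a + t *: b].

Definition is_midpoint (R : realType) (E : set 'rV[R]_3) (m : 'rV[R]_3) : Prop :=
  exists a b : 'rV[R]_3, E = segment a b /\ m = 2^-1 *: (a + b).

Definition antipodal_midpoints (R : realType) (P E E' : set 'rV[R]_3) : Prop :=
  exists m m' : 'rV[R]_3,
    [/\ is_midpoint E m, is_midpoint E' m' & antipodal P m m'].

(* Unordered pairs of distinct elements of [S] are two-element sets. *)
Definition unordered_pairs (T : Type) (S : set T) (rel : T -> T -> Prop) :
    set (set T) :=
  [set e | exists x y, [/\ S x, S y, x <> y, rel x y & e = [set x; y]]].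

(* [fset_set] sends infinite sets to the empty one; [card] is only applied to
   sets that are finite when [P] is a polytope. *)
Definition card (T : choiceType) (A : set T) : nat := #|` fset_set A |%fset.

Definition num_vertices (R : realType) (P : set 'rV[R]_3) : nat :=
  card [set v | is_vertex P v].

Definition num_antipodal_vertex_pairs (R : realType) (P : set 'rV[R]_3) : nat :=
  card (unordered_pairs [set v | is_vertex P v] (antipodal P)).

Definition num_antipodal_edge_pairs (R : realType) (P : set 'rV[R]_3) : nat :=
  card (unordered_pairs [set E | is_edge P E] (antipodal_midpoints P)).

Definition antipodal_defect (R : realType) (P : set 'rV[R]_3) : int :=
  (num_vertices P)%:Z - 1 - (num_antipodal_vertex_pairs P)%:Z
    + (num_antipodal_edge_pairs P)%:Z.

(* Main.v *)
Require Import Defs.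
From mathcomp Require Import all_boot all_order all_algebra.
From mathcomp Require Import finmap.
From mathcomp Require Import ring lra.
From mathcomp Require Import boolp classical_sets functions cardinality reals.

(* Let F(u) be the support face of [P] in direction [u], with V(u) vertices and
   E(u) edges, and let N(X) be the normal cone of a face X. The indicator functions
   of the cones N(X) /\ -N(Y) satisfy, at every u <> 0,
     sum_{X, Y edges} 1 - (sum_{X vertex} 1 - 1) (sum_{Y vertex} 1 - 1)
       = E(u) E(-u) - (V(u) - 1) (V(-u) - 1).
   On the sphere, a nonzero pointed closed convex cone has Euler characteristic 1
   and the whole space 2, so integrating the left-hand side with respect to the
   Euler characteristic gives 2 B - 2 A + 2 V - 2, twice the antipodal defect.
   The right-hand side vanishes if F(u) or F(-u) is a vertex, or if both are edges.
   Otherwise one of them is a facet, which has as many edges as vertices, and the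
   right-hand side is positive. It is thus supported on finitely many rays, and the
   defect vanishes iff no facet is opposite to an edge or a facet.
   The Euler integral is computed by projecting the cones along two generic
   directions, counting at each stage the right endpoints of intervals. *)

Set Implicit Arguments.
Unset Strict Implicit.
Unset Printing Implicit Defensive.

Import Order.TTheory GRing.Theory Num.Theory.
Local Open Scope classical_set_scope.
Local Open Scope ring_scope.

(** The constants -1 of the integrand are carried by the empty set of indices, whose normal cone is
    the whole space. The integrand thus becomes one finite weighted sum of indicators over pairs of
    index sets: the pairs of a vertex and the empty set give V in each order, and the pair of two
    empty sets gives -1 times 2. Vertices or edges X and Y are antipodal exactly when N(X) /\ -N(Y)
    contains a nonzero vector. All cones but the whole space are pointed, because a linear form
    whose maximum and minimum over a full-dimensional [P] agree is zero. No integral is ever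
    defined: an interval bounded to the right has exactly one right endpoint, so counting right
    endpoints turns the integral along a line into an equality of finite sums. This needs an
    integrand that vanishes at all but finitely many points of the line. That a polygon has as many
    edges as vertices comes from the same method, on the circle of directions modulo the normal of
    the facet. *)

Section Dot.
Variable R : realType.
Implicit Types u v w : 'rV[R]_3.

Lemma dotC u v : dot u v = dot v u.
Proof. by apply: eq_bigr => i _; rewrite mulrC. Qed.

Lemma dotDr u v w : dot u (v + w) = dot u v + dot u w.
Proof. by rewrite -big_split; apply: eq_bigr => i _; rewrite mxE mulrDr. Qed.

Lemma dotZr c u v : dot u (c *: v) = c * dot u v.
Proof. by rewrite mulr_sumr; apply: eq_bigr => i _; rewrite mxE mulrCA. Qed.

Lemma dotNr u v : dot u (- v) = - dot u v.
Proof. by rewrite -scaleN1r dotZr mulN1r. Qed.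

Lemma dotDl u v w : dot (u + v) w = dot u w + dot v w.
Proof. by rewrite !(dotC _ w) dotDr. Qed.

Lemma dotZl c u v : dot (c *: u) v = c * dot u v.
Proof. by rewrite !(dotC _ v) dotZr. Qed.

Lemma dotNl u v : dot (- u) v = - dot u v.
Proof. by rewrite !(dotC _ v) dotNr. Qed.

Lemma dot0r u : dot u 0 = 0.
Proof. by rewrite -(scale0r 0) dotZr mul0r. Qed.

Lemma dot0l u : dot 0 u = 0.
Proof. by rewrite dotC dot0r. Qed.

Definition dotlin := (dotDr, dotDl, dotNr, dotNl, dotZr, dotZl, dot0r, dot0l).

Lemma dot_sumr (I : finType) (P : pred I) u (F : I -> 'rV[R]_3) :
  dot u (\sum_(i | P i) F i) = \sum_(i | P i) dot u (F i).
Proof. exact: (big_morph (dot u) (dotDr u) (dot0r u)). Qed.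

Lemma dot_ge0 u : 0 <= dot u u.
Proof. by apply: sumr_ge0 => i _; rewrite -expr2 sqr_ge0. Qed.

Lemma dot_eq0 u : (dot u u == 0) = (u == 0).
Proof.
apply/eqP/eqP => [|->]; last by rewrite dot0r.
move=> /eqP; rewrite psumr_eq0 => [/allP u0|i _]; last by rewrite -expr2 sqr_ge0.
apply/rowP => i; rewrite mxE; apply/eqP.
by have := u0 i (mem_index_enum i); rewrite mulf_eq0 orbb.
Qed.

Lemma dot_gt0 u : (0 < dot u u) = (u != 0).
Proof. by rewrite lt_def dot_ge0 andbT dot_eq0. Qed.

(** * Cross and triple products in coordinates *)

Let i1 := @Ordinal 3 1 isT.
Let i2 := @Ordinal 3 2 isT.

Lemma dot3E u v : dot u v = u 0 0 * v 0 0 + u 0 i1 * v 0 i1 + u 0 i2 * v 0 i2.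
Proof.
rewrite /dot !big_ord_recl big_ord0 addr0 addrA.
by do ![congr (_ + _) | congr (_ * _) | congr (_ _ _) => // | exact: val_inj].
Qed.

Lemma row3P u v : u 0 0 = v 0 0 -> u 0 i1 = v 0 i1 -> u 0 i2 = v 0 i2 -> u = v.
Proof.
move=> h0 h1 h2; apply/rowP => -[[|[|[|//]]] lti].
- by rewrite (_ : Ordinal lti = 0) //; apply: val_inj.
- by rewrite (_ : Ordinal lti = i1) //; apply: val_inj.
- by rewrite (_ : Ordinal lti = i2) //; apply: val_inj.
Qed.

Definition cross u v : 'rV[R]_3 := \row_j
  [:: u 0 i1 * v 0 i2 - u 0 i2 * v 0 i1;
      u 0 i2 * v 0 0 - u 0 0 * v 0 i2;
      u 0 0 * v 0 i1 - u 0 i1 * v 0 0]`_j.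

Definition triple u v w : R := dot u (cross v w).

Lemma cross_dotl u v : dot u (cross u v) = 0.
Proof. by rewrite dot3E !mxE /=; ring. Qed.

Lemma cross_dotr u v : dot v (cross u v) = 0.
Proof. by rewrite dot3E !mxE /=; ring. Qed.

Lemma tripleC u v w : triple u v w = triple v w u.
Proof. by rewrite /triple !dot3E !mxE /=; ring. Qed.

Lemma cramer u e f g :
  triple e f g *: u = triple u f g *: e + triple e u g *: f + triple e f u *: g.
Proof. by apply: row3P; rewrite /triple !(mxE, dot3E) /=; ring. Qed.

(** Expansion of [u] in the basis dual to [v], [w], [cross v w], cleared of denominators. When
    [cross v w] is nonzero, a vector orthogonal to [v] and [w] is therefore a multiple of it. *)
Lemma cross_expand u v w :
  dot (cross v w) (cross v w) *: u = dot u (cross v w) *: cross v w +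
    (dot u w *: cross (cross v w) v - dot u v *: cross (cross v w) w).
Proof. by apply: row3P; rewrite !(mxE, dot3E) /=; ring. Qed.

Lemma cross_colinear u v : u != 0 -> cross u v = 0 -> exists c, v = c *: u.
Proof.
move=> u0 uv; exists ((dot u u)^-1 * dot u v).
apply: (@scalerI _ _ (dot u u)); first by rewrite dot_eq0.
rewrite scalerA mulrA mulfV ?dot_eq0 // mul1r.
have -> : dot u u *: v = dot u v *: u + cross (cross u v) u.
  by apply: row3P; rewrite !(mxE, dot3E) /=; ring.
by rewrite uv; apply: row3P; rewrite !(mxE, dot3E) /=; ring.
Qed.

Lemma ex_orthogonal u : exists2 a, a != 0 & dot a u = 0.
Proof.
have [u0|u0] := eqVneq u 0.
  by exists (const_mx 1); rewrite ?u0 ?dot0r //; apply/eqP => /rowP/(_ 0);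
    rewrite !mxE => /eqP; rewrite oner_eq0.
have [/eqP e1|e1] := boolP (cross u (delta_mx 0 0) == 0); last first.
  by exists (cross u (delta_mx 0 0)); rewrite // dotC cross_dotl.
(* Here [u] is a multiple of the first basis vector, so the second one is orthogonal to it. *)
exists (delta_mx 0 i1).
  by apply/eqP => /rowP/(_ i1); rewrite !mxE !eqxx => /eqP; rewrite oner_eq0.
move/rowP: e1 => e1; move: (e1 i1) (e1 i2); rewrite !mxE /= => h1 h2.
by rewrite dot3E !mxE /=; lra.
Qed.

End Dot.

(** * Properties of all sufficiently small positive reals, and generic vectors *)

Section Small.
Variable R : realType.
Implicit Types Q : R -> Prop.

(** Germs at 0 from the right: [x] acts as a positive infinitesimal, and finitely many such
    conditions hold at a common value. *)
Definition small Q := exists2 d : R, 0 < d & forall x, 0 < x < d -> Q x.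

Lemma small_and Q Q' : small Q -> small Q' -> small (fun x => Q x /\ Q' x).
Proof.
move=> [d d0 h] [d' d0' h']; exists (Num.min d d'); first by rewrite lt_min d0.
by move=> x; rewrite lt_min => /and3P[x0 xd xd']; split; [apply: h|apply: h']; apply/andP.
Qed.

Lemma small_imp Q Q' : (forall x, 0 < x -> Q x -> Q' x) -> small Q -> small Q'.
Proof. by move=> i [d d0 h]; exists d => // x /[dup] /andP[x0 _] /h; apply: i. Qed.

Lemma small_true Q : (forall x, 0 < x -> Q x) -> small Q.
Proof. by move=> i; exists 1 => // x /andP[/i]. Qed.

Lemma small_seq (T : eqType) (s : seq T) (Q : T -> R -> Prop) :
  (forall a, a \in s -> small (Q a)) -> small (fun x => forall a, a \in s -> Q a x).
Proof.
elim: s => [_|a s ih h]; first exact: small_true.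
have := small_and (h a (mem_head _ _)) (ih (fun b bs => h b (mem_behead (s := a :: s) bs))).
apply: small_imp => x _ [qa qs] b; rewrite inE => /predU1P[->//|]; exact: qs.
Qed.

Lemma small_fin (I : finType) (Q : I -> R -> Prop) :
  (forall i, small (Q i)) -> small (fun x => forall i, Q i x).
Proof.
move=> h; have := @small_seq I (enum I) Q (fun i _ => h i).
by apply: small_imp => x _ q i; apply: q; rewrite mem_enum.
Qed.

Lemma small_ex Q : small Q -> exists2 x, 0 < x & Q x.
Proof.
by move=> [d d0 h]; exists (d / 2); [|apply: h]; rewrite ?divr_gt0 ?midf_lt //=; lra.
Qed.

Lemma small_gt0 (a b : R) : 0 < a -> small (fun x => 0 < a + x * b).
Proof.
move=> a0; have b0 : 0 < 1 + `|b| by rewrite ltr_pwDl.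
exists (a / (1 + `|b|)); first by rewrite divr_gt0.
move=> x /andP[x0]; rewrite ltr_pdivlMr // mulrDr mulr1 => xd.
have : - (x * b) <= x * `|b| by rewrite -mulrN ler_pM2l // -normrN ler_norm.
lra.
Qed.

Lemma small_neq0 (a b : R) : a != 0 -> small (fun x => a + x * b != 0).
Proof.
rewrite neq_lt => /orP[a0|a0].
  have := @small_gt0 (- a) (- b); rewrite oppr_gt0 => /(_ a0).
  by apply: small_imp => x _ h; rewrite lt_eqF //; lra.
by have := @small_gt0 a b a0; apply: small_imp => x _ h; rewrite gt_eqF.
Qed.

(** The sign is lexicographic in [a], [b]: the second coefficient matters only if the first
    vanishes. *)
Lemma small_ge0 (a b : R) :
  small (fun x => (0 <= a + x * b) = (0 <= a) && ~~ ((a == 0) && (b < 0))).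
Proof.
case: (ltrgtP a 0) => [a0|a0|->] /=.
- have := @small_gt0 (- a) (- b); rewrite oppr_gt0 => /(_ a0).
  by apply: small_imp => x _ h; rewrite leNgt; apply/negbTE/negPn; lra.
- by have := @small_gt0 a b a0; apply: small_imp => x _ h; exact: ltW.
- by apply: small_true => x x0; rewrite add0r pmulr_rge0 // leNgt.
Qed.

Lemma ex_generic (s : seq 'rV[R]_3) :
  exists f : 'rV[R]_3, forall a, a \in s -> a != 0 -> dot a f != 0.
Proof.
elim: s => [|a s [f fs]]; first by exists 0.
have [af|af] := eqVneq (dot a f) 0; last first.
  by exists f => b; rewrite inE => /predU1P[->//|/fs].
have [a0|a0] := eqVneq a 0.
  by exists f => b; rewrite inE => /predU1P[->|/fs//]; rewrite a0 eqxx.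
(* A small move of [f] along [a] makes [dot a f] nonzero without cancelling the finitely many
   products that are already nonzero. *)
have : small (fun x => forall b, b \in [seq b <- s | b != 0] ->
    dot b f + x * dot b a != 0).
  apply: small_seq => b; rewrite mem_filter => /andP[b0 bs].
  exact/small_neq0/fs.
case/small_ex => x x0 h; exists (f + x *: a) => b; rewrite inE => /predU1P[-> _|bs b0].
  by rewrite dotDr dotZr af add0r mulf_neq0 ?gt_eqF ?dot_gt0.
by rewrite dotDr dotZr h // mem_filter b0.
Qed.

End Small.

(** * Polyhedral cones and the points where lines leave them *)

Section Cone.
Variable R : realType.
Implicit Types (A B : seq 'rV[R]_3) (a b e u v w : 'rV[R]_3).

Definition cone A u := all (fun a => 0 <= dot a u) A.

Lemma coneP A u : reflect (forall a, a \in A -> 0 <= dot a u) (cone A u).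
Proof. exact: allP. Qed.

Lemma coneD A u v : cone A u -> cone A v -> cone A (u + v).
Proof.
move=> /coneP hu /coneP hv; apply/coneP => a aA.
by rewrite dotDr addr_ge0 ?hu ?hv.
Qed.

Lemma coneZ A c u : 0 < c -> cone A (c *: u) = cone A u.
Proof. by move=> c0; apply: eq_all => a; rewrite dotZr pmulr_rge0. Qed.

Lemma cone0 A : cone A 0.
Proof. by apply/coneP => a _; rewrite dot0r. Qed.

Lemma cone_convex A u v (t : R) : cone A u -> cone A v -> 0 <= t <= 1 ->
  cone A ((1 - t) *: u + t *: v).
Proof.
move=> /coneP hu /coneP hv /andP[t0 t1]; apply/coneP => a aA.
by rewrite !dotlin addr_ge0 ?mulr_ge0 ?subr_ge0 ?hu ?hv.
Qed.

Lemma cone_perp B e u (t : R) :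
  (forall b, b \in B -> dot b e = 0) -> cone B (u + t *: e) = cone B u.
Proof.
by move=> Be; apply: eq_in_all => b bB; rewrite !dotlin Be // mulr0 addr0.
Qed.

(* A generic element of a cone is interior. *)
Lemma cone_generic A e v : (forall a, a \in A -> a != 0 -> dot a e != 0) ->
  cone A e -> exists t, cone A (v + t *: e).
Proof.
move=> gen /coneP Ae.
have : small (fun x => forall a, a \in [seq a <- A | a != 0] ->
    0 < dot a e + x * dot a v).
  apply: small_seq => a; rewrite mem_filter => /andP[a0 aA].
  by apply: small_gt0; rewrite lt_def gen // Ae.
case/small_ex => x x0 h; exists x^-1; apply/coneP => a aA.
have [->|a0] := eqVneq a 0; first by rewrite dot0l.
rewrite -(pmulr_rge0 _ x0) !dotlin mulrDr mulrA mulfV ?gt_eqF // mul1r addrC.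
by apply/ltW/h; rewrite mem_filter a0.
Qed.

(* [u] is the point at which the line through [u] with direction [e] leaves the cone. *)
Definition exits A e u :=
  cone A u && has (fun a => (dot a u == 0) && (dot a e < 0)) A.

(** A cone is closed, so a small step cannot enter it; the step leaves it exactly when a constraint
    is tight at [u] and decreases along [e]. *)
Lemma cone_step A e u :
  small (fun x => cone A (u + x *: e) = cone A u && ~~ exits A e u).
Proof.
have : small (fun x => forall a, a \in A -> (0 <= dot a u + x * dot a e) =
    (0 <= dot a u) && ~~ ((dot a u == 0) && (dot a e < 0))).
  by apply: small_seq => a _; exact: small_ge0.
apply: small_imp => x _ h; rewrite /exits.
case: (boolP (cone A u)) => [/coneP Au|Au] /=.
  rewrite -all_predC; apply: eq_in_all => a aA /=.
  by rewrite dotDr dotZr h // Au.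
apply/negbTE; move: Au; apply: contra => /coneP Aux; apply/coneP => a aA.
by move: (Aux a aA); rewrite dotDr dotZr h // => /andP[].
Qed.

(** A constraint that is tight at an exit and decreases along [e] excludes all later points of the
    line. *)
Lemma exits_inj A e u (s t : R) :
  exits A e (u + s *: e) -> exits A e (u + t *: e) -> s = t.
Proof.
suff le (r q : R) : exits A e (u + r *: e) -> cone A (u + q *: e) -> q <= r.
  move=> h1 h2; apply/eqP; rewrite eq_le; apply/andP.
  by split; apply: le => //; [case/andP: h1|case/andP: h2].
move=> /andP[_ /hasP[a aA /andP[/eqP a0 ae]]] /coneP/(_ a aA).
move: a0; rewrite !dotlin => a0 a1; rewrite leNgt; apply/negP => rq.
nra.
Qed.

(** Some constraint decreases along [e], so the cone meets the line in a set bounded to the right,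
    whose last point is an exit. The induction on the constraints keeps the earliest exit. *)
Lemma ex_exits A e u (s : R) : ~~ cone A e -> cone A (u + s *: e) ->
  exists2 t, s <= t & exits A e (u + t *: e).
Proof.
elim: A => // a A ih /=; rewrite negb_and.
have [ae _|ae /= Ae] := ltP (dot a e) 0; last first.
  move=> /andP[a1 A1]; have [t st /andP[tA ht]] := ih Ae A1; exists t => //.
  rewrite /exits /= tA ht orbT !andbT; move: a1; rewrite !dotlin => a1.
  by have := ler_wpM2r ae st; lra.
(* The parameter at which the constraint [a] becomes tight. *)
move=> /andP[a1 A1]; pose r := - dot a u / dot a e.
have ar : dot a (u + r *: e) = 0 by rewrite !dotlin /r; field; lra.
have sr : s <= r.
  rewrite leNgt; apply/negP => rs; move: a1; rewrite leNgt => /negP; apply.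
  by move: ar; rewrite !dotlin => ar; nra.
have [rA|rA] := boolP (cone A (u + r *: e)).
  by exists r => //; rewrite /exits /= ar rA lexx eqxx ae.
(* The other constraints fail at [r], so they are responsible for the exit, and by convexity their
   exit comes before [r]. *)
have Ae : ~~ cone A e.
  apply: contra rA => Ae; have [->//|] := eqVneq r s.
  move=> rs; have rs0 : 0 < r - s by rewrite subr_gt0 lt_def rs.
  have := coneD A1 (v := (r - s) *: e); rewrite coneZ // => /(_ Ae).
  by rewrite -addrA -scalerDl subrKC.
have [t st tA] := ih Ae A1; exists t => //; move: tA => /andP[tA ht].
rewrite /exits /= tA ht orbT !andbT.
have tr : t <= r.
  rewrite leNgt; apply: contra rA => rt.
  have ts : 0 < t - s by lra.
  pose q := (r - s) / (t - s).
  have -> : u + r *: e = (1 - q) *: (u + s *: e) + q *: (u + t *: e).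
    rewrite !scalerDr addrACA -scalerDl subrK scale1r !scalerA -scalerDl.
    by congr (_ + _ *: _); rewrite /q; field; lra.
  apply: cone_convex => //; rewrite divr_ge0 ?ler_pdivrMr //=; lra.
by move: ar; rewrite !dotlin => ar; nra.
Qed.

End Cone.

(** * Sums along a line, and projection of cones *)

Section EulerIntegration.
Variable R : realType.
Implicit Types (A B : seq 'rV[R]_3) (a b e f g u v w : 'rV[R]_3).

Lemma sum_support (T : eqType) (s s' : seq T) (F : T -> int) :
  uniq s -> uniq s' -> {subset s <= s'} -> (forall t, t \notin s -> F t = 0) ->
  \sum_(t <- s') F t = \sum_(t <- s) F t.
Proof.
move=> us us' ss' F0; rewrite (bigID (mem s)) /= [X in _ + X]big1 ?addr0 //.
rewrite -big_filter; apply/perm_big/uniq_perm; rewrite ?filter_uniq // => t.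
by rewrite mem_filter andb_idr // => /ss'.
Qed.

(* Both sides count the right endpoints of the closed intervals in which the
   cones meet the line: at [t], the sum drops by the weight of the cones that
   end there, and it vanishes just after [t]. *)
Lemma line_sum (I : finType) (c : I -> int) (A : I -> seq 'rV[R]_3) e u (T : seq R) :
  uniq T ->
  (forall t, t \notin T -> \sum_(i | cone (A i) (u + t *: e)) c i = 0) ->
  \sum_(i | ~~ cone (A i) e && `[< exists t, cone (A i) (u + t *: e) >]) c i =
  \sum_(t <- T) \sum_(i | cone (A i) (u + t *: e)) c i.
Proof.
move=> uT; set k := fun t => \sum_(i | cone (A i) (u + t *: e)) c i => k0.
have kE t : k t = \sum_(i | exits (A i) e (u + t *: e)) c i.
  have hT : small (fun x => forall r, r \in [seq r <- T | r != t] -> t + x != r).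
    apply: small_seq => r; rewrite mem_filter => /andP[rt _].
    have := @small_neq0 _ (t - r) 1; rewrite subr_eq0 eq_sym => /(_ rt).
    by apply: small_imp => x _; rewrite mulr1 addrAC subr_eq0.
  have hA := small_fin (fun i => cone_step (A i) e (u + t *: e)).
  have [x x0 [xT xA]] := small_ex (small_and hT hA).
  have : k (t + x) = 0.
    apply: k0; apply/negP => txT.
    have : t + x \in [seq r <- T | r != t] by rewrite mem_filter txT andbT; lra.
    by move/xT; rewrite eqxx.
  rewrite /k (eq_bigl (fun i => cone (A i) (u + t *: e) && ~~ exits (A i) e (u + t *: e)));
    last by move=> i; rewrite scalerDl addrA xA.
  move=> kx; rewrite [LHS](bigID (fun i => exits (A i) e (u + t *: e))) /= kx.
  by rewrite addr0; apply: eq_bigl => i; rewrite andb_idl // => /andP[].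
pose tau i := xget 0 [set t | exits (A i) e (u + t *: e)].
(* Adding the exits to [T] does not change the sum, which vanishes outside [T], and ensures that
   every exit is counted. *)
pose T' := undup (T ++ map tau (enum I)).
have uT' : uniq T' by exact: undup_uniq.
have TT' : {subset T <= T'} by move=> t tT; rewrite mem_undup mem_cat tT.
rewrite -(sum_support uT uT' TT' k0) (eq_bigr _ (fun t _ => kE t)).
rewrite (exchange_big_dep predT) //= [LHS]big_mkcond; apply: eq_bigr => i _.
case: ifPn => [/andP[ie /asboolP[s is_]]|h].
  have [t _ it] := ex_exits ie is_.
  have tauE : exits (A i) e (u + tau i *: e) by apply: (@xgetI _ 0 [set t | exits (A i) e (u + t *: e)] t).
  rewrite -big_filter (perm_big [:: tau i]) ?big_seq1 //.
  apply: uniq_perm => //; first exact: filter_uniq.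
  move=> r; rewrite mem_filter inE; apply/andP/eqP => [[ir _]|->].
    exact: exits_inj ir tauE.
  by rewrite mem_undup mem_cat map_f ?orbT // mem_enum.
rewrite big1 // => t it; case/negP: h; rewrite andbC; apply/andP; split.
  by apply/asboolP; exists t; case/andP: it.
apply/negP => ie; case/andP: it => /coneP ct /hasP[a aA /andP[_]].
by rewrite ltNge (coneP _ _ ie).
Qed.

(* Fourier-Motzkin elimination *)
Definition elim_dir A e :=
  [seq a <- A | dot a e == 0] ++
  [seq (- dot b e) *: a + dot a e *: b |
    a <- [seq a <- A | 0 < dot a e], b <- [seq b <- A | dot b e < 0]].

Lemma elim_dir_perp A e a : a \in elim_dir A e -> dot a e = 0.
Proof.
rewrite mem_cat mem_filter => /orP[/andP[/eqP]//|/allpairsP[[b b'] /= [_ _ ->]]].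
by rewrite !dotlin; ring.
Qed.

(** Either list may be empty, as happens when no constraint bounds the parameter on that side. *)
Lemma separate (s s' : seq R) : (forall x y, x \in s -> y \in s' -> x <= y) ->
  exists t, (forall x, x \in s -> x <= t) /\ (forall y, y \in s' -> t <= y).
Proof.
elim: s => [_|x s ih h].
  elim: s' => [|y s' [t [_ ht]]]; first by exists 0.
  exists (Num.min y t); split => // z; rewrite inE ge_min => /predU1P[->|/ht->].
    by rewrite lexx.
  by rewrite orbT.
have [|t [h1 h2]] := ih; first by move=> y z ys zs'; apply: h => //; rewrite inE ys orbT.
exists (Num.max x t); split=> y.
  by rewrite inE le_max => /predU1P[->|/h1->]; rewrite ?lexx ?orbT.
by move=> ys'; rewrite ge_max h2 // h // mem_head.
Qed.

Lemma elim_dirP A e u :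
  reflect (exists t, cone A (u + t *: e)) (cone (elim_dir A e) u).
Proof.
apply: (iffP idP) => [/coneP h|[t At]]; last first.
  rewrite -(cone_perp u t (@elim_dir_perp A e)).
  apply/coneP => a; rewrite mem_cat mem_filter => /orP[/andP[_]|]; first exact: (coneP _ _ At).
  move=> /allpairsP[[b b'] /= []]; rewrite !mem_filter => /andP[b0 bA] /andP[b'0 b'A] ->.
  by rewrite dotDl !dotZl addr_ge0 // mulr_ge0 ?(coneP _ _ At) // ?oppr_ge0 ltW.
(* The constraint [a] at [u + t *: e] reads [q a <= t] if [dot a e] is positive and [t <= q a] if it
   is negative. *)
pose q a := - dot a u / dot a e.
have [|t [h1 h2]] := @separate [seq q a | a <- [seq a <- A | 0 < dot a e]]
                               [seq q b | b <- [seq b <- A | dot b e < 0]].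
  move=> x y /mapP[a aA ->] /mapP[b bA ->].
  have : 0 <= dot (- dot b e *: a + dot a e *: b) u.
    by apply: h; rewrite mem_cat; apply/orP; right; apply/allpairsP; exists (a, b).
  move: aA bA; rewrite !mem_filter !dotlin /q => /andP[a0 _] /andP[b0 _] h'.
  rewrite ler_pdivrMr // mulrAC ler_ndivlMr //; lra.
exists t; apply/coneP => a aA; rewrite dotDr dotZr.
have [ae|ae|ae] := ltrgtP (dot a e) 0.
- have := h2 _ (map_f q _) => /(_ a); rewrite mem_filter ae aA => /(_ isT).
  rewrite /q ler_ndivlMr //; lra.
- have := h1 _ (map_f q _) => /(_ a); rewrite mem_filter ae aA => /(_ isT).
  rewrite /q ler_pdivrMr //; lra.
by rewrite ae mulr0 addr0; apply: h; rewrite mem_cat mem_filter ae eqxx aA.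
Qed.

End EulerIntegration.

(** * Euler integration on the circle and on the sphere *)

Section Sphere.
Variable R : realType.
Implicit Types (A B : seq 'rV[R]_3) (a b e f g u v w : 'rV[R]_3).

Lemma frame_coord e f g u : triple e f g != 0 ->
  exists x y z, u = x *: g + y *: f + z *: e.
Proof.
move=> t0; exists (triple e f u / triple e f g), (triple e u g / triple e f g),
  (triple u f g / triple e f g).
apply: (scalerI t0); rewrite cramer !scalerDr !scalerA.
by rewrite ![triple e f g * _]mulrC !divfK // addrC addrA addrAC.
Qed.

Lemma frame_free e f g (x y z : R) : triple e f g != 0 ->
  x *: g + y *: f = z *: e -> x = 0.
Proof.
rewrite tripleC tripleC => t0 /(congr1 (fun v => dot v (cross e f))).
rewrite !dotlin cross_dotl cross_dotr !mulr0 addr0 => /eqP.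
by rewrite mulf_eq0 (negbTE t0) orbF => /eqP.
Qed.

(* The cones [B i] contain the line [R e]; modulo that line, [line_sum] is
   applied on the two sides of the generic line spanned by [f]. *)
Lemma circle_sum (I : finType) (c : I -> int) (B : I -> seq 'rV[R]_3) e f g (T T' : seq R) :
  triple e f g != 0 ->
  (forall i b, b \in B i -> dot b e = 0) ->
  (forall i b, b \in B i -> b != 0 -> dot b f != 0) ->
  (forall i, (forall u, cone (B i) u) \/
     (forall u, cone (B i) u -> cone (B i) (- u) -> exists z, u = z *: e)) ->
  uniq T -> uniq T' ->
  (forall s, s \notin T -> \sum_(i | cone (B i) (g + s *: f)) c i = 0) ->
  (forall s, s \notin T' -> \sum_(i | cone (B i) (- g + s *: - f)) c i = 0) ->
  \sum_(i | `[< exists2 u, cone (B i) u & ~~ cone (B i) (- u) >]) c i =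
  \sum_(s <- T) \sum_(i | cone (B i) (g + s *: f)) c i +
  \sum_(s <- T') \sum_(i | cone (B i) (- g + s *: - f)) c i.
Proof.
move=> efg Be gen dich uT uT' h h'; rewrite -!line_sum //.
pose P1 i := ~~ cone (B i) f && `[< exists s, cone (B i) (g + s *: f) >].
pose P2 i := ~~ cone (B i) (- f) && `[< exists s, cone (B i) (- g + s *: - f) >].
pose Q i := `[< exists2 u, cone (B i) u & ~~ cone (B i) (- u) >].
rewrite -[LHS]/(\sum_(i | Q i) c i) -[RHS]/(\sum_(i | P1 i) c i + \sum_(i | P2 i) c i).
(* As [s] increases, [g + s *: f] and then [- g + s *: - f] go once around the circle modulo [e], in
   one sense. A sector that is neither trivial nor everything has a single end, on exactly one of
   the two lines. *)
suff {h h'} PQ i : Q i = P1 i (+) P2 i /\ ~~ (P1 i && P2 i).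
  rewrite (bigID P1) /=; congr (_ + _); apply: eq_bigl => i; have [-> +] := PQ i;
    by case: (P1 i); case: (P2 i).
rewrite /Q /P1 /P2 {P1 P2 Q}.
have BeC u z : cone (B i) (u + z *: e) = cone (B i) u by exact/cone_perp/Be.
case: (dich i) => [all_|pointed].
  by rewrite !all_ /=; split=> //; apply/asboolP => -[u _]; rewrite all_.
have gen' : forall b, b \in B i -> b != 0 -> dot b (- f) != 0.
  by move=> b bB b0; rewrite dotNr oppr_eq0 (gen i).
(* By genericity, only zero constraints vanish at [f]. *)
have fN : cone (B i) f -> cone (B i) (- f) -> forall u, cone (B i) u.
  move=> cf cNf u; apply/coneP => b bB; have [->|b0] := eqVneq b 0.
    by rewrite dot0l.
  have := gen i b bB b0; move/coneP: cf => /(_ b bB).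
  move/coneP: cNf => /(_ b bB); rewrite dotNr oppr_ge0 => h1 h2.
  by rewrite (le_anti (introT andP (conj h1 h2))) eqxx.
(* A proper sector around [f] ends on the second line, and one around [- f] on the first. *)
have [c1|c1] /= := boolP (cone (B i) f).
  have [c2|c2] /= := boolP (cone (B i) (- f)).
    by split=> //; apply/asboolP => -[u _]; rewrite fN.
  have -> : `[< exists t, cone (B i) (- g + t *: - f) >].
    apply/asboolP; have [t ht] := cone_generic (- g) (gen i) c1.
    by exists (- t); rewrite scalerN scaleNr opprK.
  by split=> //; apply/asboolP; exists f.
have [c2|c2] /= := boolP (cone (B i) (- f)).
  have -> : `[< exists t, cone (B i) (g + t *: f) >].
    apply/asboolP; have [t ht] := cone_generic g gen' c2.
    by exists (- t); rewrite scaleNr -scalerN.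
  by split=> //; apply/asboolP; exists (- f); rewrite ?opprK.
have gf (s : R) : cone (B i) (g + s *: f) -> ~~ cone (B i) (- (g + s *: f)).
  move=> h1; apply/negP => /(pointed _ h1)[z /eqP]; rewrite -(scale1r g).
  by move/eqP/(frame_free efg)/eqP; rewrite oner_eq0.
have gf' (s : R) : - g + s *: - f = - (g + s *: f) by rewrite scalerN opprD.
(* A point of the first line plus a point of the second is a multiple of [f]. The remaining sectors
   contain neither [f] nor [- f], so the two points would be opposite, against [gf]. *)
have nboth : ~~ (`[< exists t, cone (B i) (g + t *: f) >] &&
                 `[< exists t, cone (B i) (- g + t *: - f) >]).
  apply/negP => /andP[/asboolP[s hs] /asboolP[t ht]].
  have := coneD hs ht; rewrite addrACA subrr add0r scalerN -scalerBl.
  have [st|st|st] := ltrgtP s t.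
  - by rewrite -(opprB t) scaleNr -scalerN coneZ ?subr_gt0 // (negbTE c2).
  - by rewrite coneZ ?subr_gt0 // (negbTE c1).
  - by move=> _; move: (gf _ hs); rewrite -gf' st ht.
split=> //; apply/asboolP/idP => [[u cu cNu]|]; last first.
  have [/asboolP[s hs] _|_ /=] := boolP `[< exists t, cone (B i) (g + t *: f) >].
    by exists (g + s *: f) => //; exact: gf.
  move/asboolP => [s hs]; exists (- g + s *: - f) => //.
  by apply/negP; rewrite gf' opprK => /gf/negP; apply; rewrite -gf'.
suff : `[< exists t, cone (B i) (g + t *: f) >] ||
       `[< exists t, cone (B i) (- g + t *: - f) >].
  by move: nboth; do 2!case: `[< _ >].
have [x [y [z uE]]] := frame_coord u efg.
move: cu cNu; rewrite uE 2!opprD -(scaleNr z) !BeC => cu cNu.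
have [x0|x0|x0] := ltrgtP x 0.
- apply/orP; right; apply/asboolP; exists (y / x).
  have nx : 0 < - x by rewrite oppr_gt0.
  rewrite -(coneZ _ _ nx) scalerDr scalerA mulNr mulrCA mulfV ?lt_eqF // mulr1.
  by rewrite scalerN scaleNr opprK scaleNr scalerN opprK.
- apply/orP; left; apply/asboolP; exists (y / x).
  by rewrite -(coneZ _ _ x0) scalerDr scalerA mulrCA mulfV ?gt_eqF // mulr1.
- move: cu cNu; rewrite x0 scale0r oppr0 !add0r.
  have [y0|y0|->] := ltrgtP y 0.
  + by rewrite -[y]opprK scaleNr -scalerN coneZ ?oppr_gt0 // (negbTE c2).
  + by rewrite coneZ // (negbTE c1).
  + by rewrite scale0r oppr0 cone0.
Qed.

(* The weighted count of the cones, a whole space counting twice as [S^2] has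
   Euler characteristic 2, is the sum of [h] over its supporting rays; those that
   are off the plane spanned by two generic vectors [e] and [f] are listed in [L]. *)
Lemma sphere_sum (I : finType) (c : I -> int) (A : I -> seq 'rV[R]_3)
    (U : seq 'rV[R]_3) (h := fun u => \sum_(i | cone (A i) u) c i) g :
  (forall i, (forall u, cone (A i) u) \/
     (forall u, cone (A i) u -> cone (A i) (- u) -> u = 0)) ->
  (forall u, u != 0 -> h u != 0 -> exists2 w, w \in U & exists z, u = z *: w) ->
  g != 0 ->
  exists L : seq 'rV[R]_3, [/\ forall v, v \in L -> v != 0,
    h g != 0 -> g \in L &
    \sum_(i | `[< exists2 u, cone (A i) u & ~~ cone (A i) (- u) >]) c i +
    (\sum_(i | `[< forall u, cone (A i) u >]) c i) *+ 2 = \sum_(v <- L) h v].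
Proof.
move=> dich supp g0.
(* Making [e] generic for a vector orthogonal to each [w] in [g :: U] keeps [e] off the lines
   spanned by these [w]. *)
have [orth orth0 orthE] : exists2 o : 'rV[R]_3 -> 'rV[R]_3,
    forall u, o u != 0 & forall u, dot (o u) u = 0.
  exists (fun u => xget 0 [set a | a != 0 /\ dot a u = 0]) => u;
    have [a a0 au] := ex_orthogonal u;
    by have [] := @xgetI _ 0 [set a | a != 0 /\ dot a u = 0] a (conj a0 au).
have [e egen] := ex_generic (flatten [seq A i | i <- enum I] ++ map orth (g :: U)).
have eA i a : a \in A i -> a != 0 -> dot a e != 0.
  move=> aA; apply: egen; rewrite mem_cat; apply/orP; left.
  by apply/flattenP; exists (A i); rewrite ?map_f ?mem_enum.
have eU w z : w \in g :: U -> e != z *: w.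
  move=> wU; apply/eqP => ew; have : dot (orth w) e != 0.
    by apply: egen => //; rewrite mem_cat map_f ?orbT.
  by rewrite ew dotZr orthE mulr0 eqxx.
have e0 : e != 0 by have := eU g 0 (mem_head _ _); rewrite scale0r.
have ge0 : cross g e != 0.
  apply/eqP => /(cross_colinear g0)[z /eqP]; apply/negP; exact: eU (mem_head _ _).
pose B i := elim_dir (A i) e.
have [f fgen] := ex_generic (cross g e :: flatten [seq B i | i <- enum I]).
have fB i b : b \in B i -> b != 0 -> dot b f != 0.
  move=> bB; apply: fgen; rewrite inE; apply/orP; right.
  by apply/flattenP; exists (B i); rewrite ?map_f ?mem_enum.
have efg : triple e f g != 0.
  by rewrite tripleC /triple dotC fgen ?mem_head.
have he0 (s : R) : s != 0 -> h (s *: e) = 0.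
  move=> s0; apply/eqP/negP => /negP /supp []; first by rewrite scaler_eq0 negb_or s0.
  move=> w wU [z /(congr1 (fun v => s^-1 *: v))]; rewrite !scalerA mulVf // scale1r.
  by apply/eqP/eU; rewrite inE wU orbT.
(* By Cramer's rule, these are the coordinates along [g], [f], [e], up to the factor [triple e f g].
   A line spanned by [w] with [x w] nonzero meets the plane of [g]-coordinate [r], equal to 1 or -1,
   where [s = y w / x w] and [t = r * (z w / x w)]. *)
pose x w := triple e f w; pose y w := triple e w g; pose z w := triple w f g.
pose T2 := undup [seq y w / x w | w <- U].
pose T1 (r : R) := undup [seq r * (z w / x w) | w <- U].
have xZ q w : x (q *: w) = q * x w by rewrite /x /triple !(mxE, dot3E) /=; ring.
have xE (r s t : R) : x (r *: (g + s *: f) + t *: e) = r * triple e f g.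
  by rewrite /x /triple !(mxE, dot3E) /=; ring.
have v_neq0 (r s t : R) : r * r = 1 -> r *: (g + s *: f) + t *: e != 0.
  move=> rr; apply/eqP => v0; have := xE r s t; rewrite v0 -(scale0r g) xZ mul0r.
  move/esym/eqP; rewrite mulf_eq0 (negbTE efg) orbF => /eqP r0.
  by move: rr; rewrite r0 mul0r => /esym/eqP; rewrite oner_eq0.
have hT (r s t : R) : r * r = 1 -> h (r *: (g + s *: f) + t *: e) != 0 ->
    s \in T2 /\ t \in T1 r.
  move=> rr; set v := _ + _ => hv.
  have r0 : r != 0.
    by apply: contra_eqN rr => /eqP ->; rewrite mul0r eq_sym oner_eq0.
  have xv : x v = r * triple e f g by exact: xE.
  have yv : y v = r * s * triple e f g.
    by rewrite /y /v /triple !(mxE, dot3E) /=; ring.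
  have zv : z v = t * triple e f g.
    by rewrite /z /v /triple !(mxE, dot3E) /=; ring.
  have v0 : v != 0 by exact: v_neq0.
  have [w wU [q vw]] := supp v v0 hv.
  have xw : x v = q * x w by rewrite vw xZ.
  have yw : y v = q * y w by rewrite vw /y /triple !(mxE, dot3E) /=; ring.
  have zw : z v = q * z w by rewrite vw /z /triple !(mxE, dot3E) /=; ring.
  have : q * x w != 0 by rewrite -xw xv mulf_neq0.
  rewrite mulf_eq0 negb_or => /andP[q0 xw0].
  have sE : y w / x w = s.
    suff -> : y w = s * x w by rewrite mulfK.
    by apply: (mulfI q0); rewrite -yw yv mulrCA -xw xv; ring.
  have tE : r * (z w / x w) = t.
    suff -> : z w = t * r * x w by rewrite mulfK // mulrCA rr mulr1.
    apply: (mulfI q0); rewrite -zw zv.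
    by rewrite mulrCA -xw xv mulrA -[t * r * r]mulrA rr mulr1.
  by rewrite -{1}sE -tE !mem_undup; split; apply: map_f.
(* A cone that contains [e] has no right endpoint on a line of direction [e]. *)
pose c' i := if cone (A i) e then 0 else c i.
have kE (r s : R) : r * r = 1 -> \sum_(i | cone (B i) (r *: (g + s *: f))) c' i =
    \sum_(t <- T1 r) h (r *: (g + s *: f) + t *: e).
  move=> rr; rewrite -line_sum ?undup_uniq //; last first.
    by move=> t; apply: contraNeq => /(hT r s t rr)[].
  rewrite [LHS]big_mkcond [RHS]big_mkcond; apply: eq_bigr => i _; rewrite /c'.
  case: (cone (A i) e) => /=; first by case: ifP.
  by congr (if _ then _ else _); apply/elim_dirP/asboolP.
have kE1 s : \sum_(i | cone (B i) (g + s *: f)) c' i =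
    \sum_(t <- T1 1) h (g + s *: f + t *: e).
  by have := kE 1 s (mulr1 1); rewrite scale1r.
have dN s : - g + s *: - f = (-1) *: (g + s *: f).
  by rewrite scaleN1r opprD scalerN.
have kE2 s : \sum_(i | cone (B i) (- g + s *: - f)) c' i =
    \sum_(t <- T1 (-1)) h (- g + s *: - f + t *: e).
  by rewrite dN kE // mulrNN mulr1.
exists ([seq g + s *: f + t *: e | s <- T2, t <- T1 1] ++
        [seq - g + s *: - f + t *: e | s <- T2, t <- T1 (-1)]); split.
- move=> v; rewrite mem_cat => /orP[] /allpairsP[[s t] /= [_ _ ->]].
    by have := v_neq0 1 s t (mulr1 1); rewrite scale1r.
  by rewrite dN v_neq0 // mulrNN mulr1.
(* The vector [g] is the origin [s = t = 0] of the first plane. *)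
- move=> hg; rewrite mem_cat; apply/orP; left; apply/allpairsP; exists (0, 0) => /=.
  rewrite !scale0r !addr0; split => //.
    have := hT 1 0 0 (mulr1 1); rewrite scale1r !scale0r !addr0 => /(_ hg)[//].
  have := hT 1 0 0 (mulr1 1); rewrite scale1r !scale0r !addr0 => /(_ hg)[//].
rewrite big_cat !big_allpairs_dep /=.
under [in RHS]eq_bigr do rewrite -kE1.
rewrite (eq_bigr _ (fun s _ => esym (kE2 s))).
have h0 (r s : R) : r * r = 1 -> s \notin T2 ->
    \sum_(t <- T1 r) h (r *: (g + s *: f) + t *: e) = 0.
  move=> rr sT; apply: big1 => t _; apply: contraNeq sT => hv.
  by have [] := hT r s t rr hv.
have pt i : ~ (forall u, cone (A i) u) ->
    forall u, cone (A i) u -> cone (A i) (- u) -> u = 0.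
  by case: (dich i).
have Bpt i : ~ (forall u, cone (A i) u) -> ~~ cone (A i) e -> ~~ cone (A i) (- e) ->
    forall u, cone (B i) u -> cone (B i) (- u) -> exists z, u = z *: e.
  move=> npos Ae ANe u /elim_dirP[s us] /elim_dirP[t ut].
  have := coneD us ut; rewrite addrACA subrr add0r -scalerDl.
  have [st|st|st] := ltrgtP (s + t) 0.
  - by rewrite -[s + t]opprK scaleNr -scalerN coneZ ?oppr_gt0 // (negbTE ANe).
  - by rewrite coneZ // (negbTE Ae).
  - move=> _; exists (- s); apply/eqP; rewrite -subr_eq0 scaleNr opprK; apply/eqP.
    apply: (pt i npos _ us); move: ut; have -> : t = - s by lra.
    by rewrite opprD scaleNr.
have eAN i a : a \in A i -> a != 0 -> dot a (- e) != 0.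
  by move=> aA a0; rewrite dotNr oppr_eq0 (eA i).
have shN i u : cone (A i) (- e) -> cone (B i) u.
  move=> ANe; apply/elim_dirP; have [t ut] := cone_generic u (@eAN i) ANe.
  by exists (- t); rewrite scaleNr -scalerN.
have Bdich i : (forall u, cone (B i) u) \/
    (forall u, cone (B i) u -> cone (B i) (- u) -> exists z, u = z *: e).
  have [all_|npos] := pselect (forall u, cone (A i) u).
    by left => u; apply/elim_dirP; exists 0.
  have [Ae|Ae] := boolP (cone (A i) e).
    by left => u; apply/elim_dirP; exact: cone_generic (@eA i) Ae.
  have [ANe|ANe] := boolP (cone (A i) (- e)); last by right; exact: Bpt.
  by left => u; exact: shN.
have -> : \sum_(s <- T2) \sum_(i | cone (B i) (g + s *: f)) c' i +
    \sum_(s <- T2) \sum_(i | cone (B i) (- g + s *: - f)) c' i =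
    \sum_(i | `[< exists2 u, cone (B i) u & ~~ cone (B i) (- u) >]) c' i.
  apply/esym.
  apply: (@circle_sum _ c' B e f g T2 T2 efg _ fB Bdich (undup_uniq _) (undup_uniq _)).
  - by move=> i b; exact: elim_dir_perp.
  - by move=> s /(h0 1 s (mulr1 1)); rewrite kE1 scale1r.
  - by move=> s /(h0 (-1) s); rewrite kE2 dN; apply; rewrite mulrNN mulr1.
(* The values of [h] at the two poles are zero, but they restore the missing terms cone by cone: the
   cones that contain [e], dropped by [c']; those that contain [- e], whose projection is
   everything; and the whole space, which contains both poles and so counts twice. *)
have <- : h e + h (- e) + \sum_(i | `[< exists2 u, cone (B i) u & ~~ cone (B i) (- u) >]) c' i =
    \sum_(i | `[< exists2 u, cone (B i) u & ~~ cone (B i) (- u) >]) c' i.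
  have := he0 1 (oner_neq0 _); rewrite scale1r => ->.
  have := he0 (-1); rewrite oppr_eq0 oner_eq0 scaleN1r => /(_ isT) ->.
  by rewrite !add0r.
rewrite /h mulr2n !(big_mkcond (fun i => `[< _ >])) !(big_mkcond (fun i => cone (A i) _)) /=.
rewrite -!big_split /=; apply: eq_bigr => i _; rewrite /c'.
have [/asboolP all_|/asboolP npos] := boolP `[< forall u, cone (A i) u >].
  rewrite !all_ if_same addr0 asboolF ?add0r // => -[u _].
  by rewrite all_.
have {}pt := pt i npos.
rewrite !addr0.
have [Ae|Ae] := boolP (cone (A i) e).
  have ANe : ~~ cone (A i) (- e) by apply: contraNN e0 => /(pt _ Ae)/eqP.
  by rewrite (negbTE ANe) if_same !addr0 asboolT //; exists e.
have [ANe|ANe] := boolP (cone (A i) (- e)).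
  rewrite asboolT; last by exists (- e); rewrite ?opprK.
  rewrite add0r asboolF ?addr0 // => -[u _ /negP]; apply; exact: shN.
rewrite !add0r; congr (if _ then _ else _); apply: asbool_equiv_eq; split=> -[u].
  move=> cu cNu; exists u; first by apply/elim_dirP; exists 0; rewrite scale0r addr0.
  apply/negP => bNu.
  have bu : cone (B i) u by apply/elim_dirP; exists 0; rewrite scale0r addr0.
  have [q uq] := Bpt i npos Ae ANe u bu bNu.
  have [q0|q0|q0] := ltrgtP q 0.
  - move: cu; rewrite uq -[q]opprK scaleNr -scalerN coneZ ?oppr_gt0 //; exact/negP.
  - move: cu; rewrite uq coneZ //; exact/negP.
  - by move: cNu; rewrite uq q0 scale0r oppr0 cone0.
move=> /elim_dirP[t cu] bNu; exists (u + t *: e) => //.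
apply: contra bNu => cNu; apply/elim_dirP; exists (- t).
by rewrite scaleNr -opprD.
Qed.

End Sphere.

(** * Support faces as sets of indices *)

Section Faces.
Variables (R : realType) (n : nat) (p : 'I_n -> 'rV[R]_3).
Implicit Types (u v h d : 'rV[R]_3) (X Y : {set 'I_n}) (i j : 'I_n).

(** Relative to [Y], so that a face of a face can be expressed. *)
Definition face Y h := [set i in Y | [forall j in Y, dot h (p j) <= dot h (p i)]]%SET.

(* Faces are represented by the indices of the points [p i] that they contain. *)
Definition top u := face [set: 'I_n] u.

Lemma faceP Y h i : reflect (i \in Y /\ forall j, j \in Y -> dot h (p j) <= dot h (p i))
  (i \in face Y h).
Proof.
rewrite inE; apply: (iffP andP) => -[iY hi]; split => //.
  by move=> j jY; have /forallP/(_ j)/implyP/(_ jY) := hi.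
by apply/forall_inP.
Qed.

Lemma topP u i : reflect (forall j, dot u (p j) <= dot u (p i)) (i \in top u).
Proof.
apply: (iffP (faceP _ _ _)) => [[_ h] j|h]; first by apply: h; rewrite inE.
by split; rewrite ?inE.
Qed.

Lemma face_sub Y h : face Y h \subset Y.
Proof. by apply/fintype.subsetP => i /faceP[]. Qed.

Lemma face_dot Y h i j : i \in face Y h -> j \in face Y h -> dot h (p i) = dot h (p j).
Proof.
move=> /faceP[iY hi] /faceP[jY hj]; apply/eqP.
by rewrite eq_le hi // hj.
Qed.

Lemma face_eqdot Y h i j : i \in face Y h -> j \in Y -> dot h (p i) = dot h (p j) ->
  j \in face Y h.
Proof. by move=> /faceP[iY hi] jY ij; apply/faceP; rewrite -ij. Qed.

Lemma face_ex Y h i : i \in Y -> exists j, j \in face Y h.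
Proof.
move=> iY; case: (@arg_maxP _ _ _ i (mem Y) (fun j => dot h (p j)) iY) => j jY hj.
by exists j; apply/faceP.
Qed.

Lemma topZ (c : R) u : 0 < c -> top (c *: u) = top u.
Proof.
move=> c0; apply/setP => i; apply/topP/topP => h j; have := h j;
  by rewrite !dotZl ler_pM2l.
Qed.

(** For a small perturbation [u] decides first and [h] breaks the ties. Hence a face of a support
    face is again a support face. *)
Lemma top_perturb u h : small (fun x => top (u + x *: h) = face (top u) h).
Proof.
have : small (fun x => forall i j, (0 <= dot u (p i - p j) + x * dot h (p i - p j)) =
   (0 <= dot u (p i - p j)) && ~~ ((dot u (p i - p j) == 0) && (dot h (p i - p j) < 0))).
  by apply: small_fin => i; apply: small_fin => j; exact: small_ge0.
apply: small_imp => x _ H; apply/setP => i.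
have E j : (dot (u + x *: h) (p j) <= dot (u + x *: h) (p i)) =
    (dot u (p j) <= dot u (p i)) &&
    ~~ ((dot u (p i) == dot u (p j)) && (dot h (p i) < dot h (p j))).
  have := H i j; rewrite !dotDr !dotNr subr_eq0 subr_ge0 subr_lt0 => <-.
  by rewrite -subr_ge0 !dotlin; congr (_ <= _); ring.
apply/topP/faceP => [hi|[/topP iu hi] j].
  have iu : i \in top u by apply/topP => j; have := hi j; rewrite E => /andP[].
  split=> // j ju; have := hi j; rewrite E (face_dot iu ju) eqxx /= => /andP[_].
  by rewrite leNgt.
rewrite E iu /=; apply/negP => /andP[/eqP ij]; apply/negP; rewrite -leNgt; apply: hi.
by apply/topP => k; rewrite -ij.
Qed.

(** The points [p i] may repeat, so a vertex is a set of indices with a common point rather than a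
    single index. *)
Definition const X := [forall i in X, forall j in X, p i == p j].

(** As [d] may be 0, a single point counts as collinear; for nonzero [u], the negation of
    [line (top u)] singles out the facets. *)
Definition line X := exists d, forall i j, i \in X -> j \in X -> exists t, p i - p j = t *: d.

Lemma constP X : reflect (forall i j, i \in X -> j \in X -> p i = p j) (const X).
Proof.
apply: (iffP forall_inP) => h i => [j iX jX|iX].
  by have /forall_inP/(_ j jX)/eqP := h i iX.
by apply/forall_inP => j jX; apply/eqP/h.
Qed.

Lemma const_line X : const X -> line X.
Proof.
move/constP => cX; exists 0 => i j iX jX; exists 0.
by rewrite (cX i j) // subrr scaler0.
Qed.

Lemma nconst_ex X : ~~ const X -> exists i j, [/\ i \in X, j \in X & p i != p j].
Proof.
move=> /forall_inPn[i iX /forall_inPn[j jX ij]]; by exists i, j.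
Qed.

Definition is_vtx X := `[< exists u, [/\ u != 0, X = top u & const X] >].

Definition is_edg X := `[< exists u, [/\ u != 0, X = top u, ~~ const X & line X] >].

Definition vtx_count Y := #|[set X | is_vtx X & X \subset Y]%SET|.
Definition edg_count Y := #|[set X | is_edg X & X \subset Y]%SET|.

(* Two distinct directions of constancy confine the points to a line. *)
Lemma normal_unique X u v : ~ line X -> u != 0 ->
  (forall i j, i \in X -> j \in X -> dot u (p i) = dot u (p j)) ->
  (forall i j, i \in X -> j \in X -> dot v (p i) = dot v (p j)) ->
  exists z, v = z *: u.
Proof.
move=> nl u0 hu hv; have [/eqP uv|uv] := boolP (cross u v == 0).
  exact: cross_colinear.
case: nl; exists (cross u v) => i j iX jX.
exists ((dot (cross u v) (cross u v))^-1 * dot (p i - p j) (cross u v)).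
apply: (@scalerI _ _ (dot (cross u v) (cross u v))); first by rewrite dot_eq0.
rewrite scalerA mulrA mulfV ?dot_eq0 // mul1r cross_expand.
rewrite !(dotDl (p i)) !dotNl !(dotC (p i)) !(dotC (p j)) (hu i j) // (hv i j) //.
by rewrite !subrr !scale0r subrr addr0.
Qed.

(** Constraints of the normal cone of [X] relative to [Y]. *)
Definition diffs X Y := [seq p i - p j | i <- enum X, j <- enum Y].

Lemma cone_diffs X Y h : X \subset Y -> cone (diffs X Y) h = (X \subset face Y h).
Proof.
move=> XY; apply/coneP/fintype.subsetP => [H i iX|H a].
  apply/faceP; split; first exact: (fintype.subsetP XY).
  move=> j jY; have := H (p i - p j); rewrite dotC dotDr dotNr subr_ge0; apply.
  by apply/allpairsP; exists (i, j); rewrite /= !mem_enum.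
move=> /allpairsP[[i j] /=]; rewrite !mem_enum => -[/H /faceP[iY hi] jY ->].
by rewrite dotC dotDr dotNr subr_ge0 hi.
Qed.

Hypothesis full : forall u, (forall i j, dot u (p i) = dot u (p j)) -> u = 0.
Variable i0 : 'I_n.

Lemma top_ex u : exists i, i \in top u.
Proof. by apply: (face_ex u (i := i0)); rewrite inE. Qed.

Lemma nline_setT : ~ line [set: 'I_n]%SET.
Proof.
move=> [d hd]; have [a a0 ad] := ex_orthogonal d.
move/eqP: a0; apply; apply: full => i j; apply/eqP; rewrite -subr_eq0 -dotNr -dotDr.
by have [||t ->] := hd i j; rewrite ?inE ?dotZr ?ad ?mulr0.
Qed.

Lemma line_top_neq0 u : line (top u) -> u != 0.
Proof.
apply: contraPneq => ->; suff -> : top 0 = [set: 'I_n]%SET by exact: nline_setT.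
by apply/setP => i; rewrite finset.in_setT; apply/topP => j; rewrite !dot0l.
Qed.

(** A linear form whose maximum and minimum agree is constant on the points. This is what makes the
    normal cones pointed. *)
Lemma top_oppI u i : i \in top u -> i \in top (- u) -> u = 0.
Proof.
move=> /topP h1 /topP h2; apply: full => j k.
have e l : dot u (p l) = dot u (p i).
  by apply/eqP; rewrite eq_le h1 -lerN2 -!dotNl h2.
by rewrite !e.
Qed.

Lemma is_vtx_top u : const (top u) -> is_vtx (top u).
Proof. by move=> c; apply/asboolP; exists u; split=> //; exact/line_top_neq0/const_line. Qed.

Lemma is_edg_top u : ~~ const (top u) -> line (top u) -> is_edg (top u).
Proof. by move=> c l; apply/asboolP; exists u; split=> //; exact: line_top_neq0. Qed.

Lemma vtx_ex X : is_vtx X -> exists i, i \in X.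
Proof. by move=> /asboolP[u [_ -> _]]; exact: top_ex. Qed.

(** A support face contains all the indices of any point that it contains. *)
Lemma vtx_sub_const X Y : is_vtx X -> X \subset Y -> const Y -> X = Y.
Proof.
move=> Xv XY /constP cY; apply/eqP; rewrite finset.eqEsubset XY; apply/fintype.subsetP => j jY.
have [i iX] := vtx_ex Xv; have ij := cY i j (fintype.subsetP XY i iX) jY.
move: Xv iX => /asboolP[u [_ -> _]] iu.
by apply: face_eqdot iu _ _; rewrite ?inE ?ij.
Qed.

(** * Numbers of vertices and edges of a support face *)

Lemma count_const u : const (top u) -> vtx_count (top u) = 1%N /\ edg_count (top u) = 0%N.
Proof.
move=> cY; rewrite /vtx_count /edg_count; split.
  rewrite (_ : [set X | _]%SET = [set top u]%SET) ?cards1 //.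
  apply/setP => X; rewrite !inE; apply/andP/eqP => [[Xv XY]|->].
    exact: vtx_sub_const.
  by rewrite is_vtx_top.
apply/eqP; rewrite cards_eq0; apply/eqP/setP => X; rewrite !inE.
apply/negP => /andP[/asboolP[v [_ _ /nconst_ex[i [j [iX jX ij]]] _]] XY].
by move/constP: cY => /(_ i j (fintype.subsetP XY i iX) (fintype.subsetP XY j jX))/eqP; rewrite (negbTE ij).
Qed.

(** Along a segment of direction [d], a linear form [v] varies with the sign of [dot v d]. A support
    face inside the segment is thus one of the two ends, selected by [d] and [- d], or all of it
    when [v] is orthogonal to [d]. *)
Lemma count_line u : ~~ const (top u) -> line (top u) ->
  vtx_count (top u) = 2%N /\ edg_count (top u) = 1%N.
Proof.
set Y := top u => nc lY; have [d hd] := lY.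
have [a [b [aY bY ab]]] := nconst_ex nc.
have d0 : d != 0.
  apply: contraNneq ab => d0; have [t] := hd a b aY bY.
  by rewrite d0 scaler0 => /eqP; rewrite subr_eq0.
have dd : 0 < dot d d by rewrite dot_gt0.
have dE i j : i \in Y -> j \in Y -> exists2 t, p i - p j = t *: d &
    forall v, dot v (p i) - dot v (p j) = t * dot v d.
  move=> iY jY; have [t ht] := hd i j iY jY; exists t => // v.
  by rewrite -dotNr -dotDr ht dotZr.
have cst (v : 'rV[R]_3) : dot v d != 0 -> const (face Y v).
  move=> vd; apply/constP => i j iv jv.
  have iY := fintype.subsetP (face_sub _ _) i iv; have jY := fintype.subsetP (face_sub _ _) j jv.
  have [t ht /(_ v)] := dE i j iY jY.
  rewrite (face_dot iv jv) subrr => /esym/eqP; rewrite mulf_eq0 (negbTE vd) orbF => /eqP t0.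
  by apply/eqP; rewrite -subr_eq0 ht t0 scale0r.
have fvtx (v : 'rV[R]_3) : dot v d != 0 -> is_vtx (face Y v).
  move=> vd; have [x _ xE] := small_ex (top_perturb u v).
  by rewrite -xE; apply: is_vtx_top; rewrite xE; apply: cst.
have sub1 X v : X = top v -> X \subset Y -> dot v d = 0 -> X = Y.
  move=> Xv XY vd; apply/eqP; rewrite finset.eqEsubset XY; apply/fintype.subsetP => j jY.
  have [i] := top_ex v; rewrite -Xv => iX; have iY := fintype.subsetP XY i iX.
  rewrite Xv in iX *; apply: face_eqdot iX _ _; rewrite ?inE //.
  have [t _ /(_ v)] := dE i j iY jY; rewrite vd mulr0 => /eqP; rewrite subr_eq0 => /eqP //.
have sub2 X v w : is_vtx X -> X = top v -> X \subset Y -> 0 < dot v d * dot w d ->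
    X = face Y w.
  move=> Xvtx Xv XY vw.
  have wd : dot w d != 0 by apply: contraTneq vw => ->; rewrite mulr0 ltxx.
  apply: vtx_sub_const => //; last exact: cst.
  apply/fintype.subsetP => i iX; have iY := fintype.subsetP XY i iX; apply/faceP; split=> // j jY.
  have [t _ tE] := dE j i jY iY; have := tE w; have := tE v.
  have : dot v (p j) <= dot v (p i) by move: iX; rewrite Xv => /topP.
  by move: vw; nra.
have d1 : 0 < dot d d * dot d d by rewrite mulr_gt0.
have sub3 X : is_vtx X -> X \subset Y -> X = face Y d \/ X = face Y (- d).
  move=> Xvtx XY; have /asboolP[v [_ Xv cX]] := Xvtx.
  have [vd|vd|vd] := ltrgtP (dot v d) 0.
  - by right; apply: (sub2 X v) => //; rewrite dotNl mulrN -mulNr mulr_gt0 ?oppr_gt0.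
  - by left; apply: (sub2 X v) => //; rewrite mulr_gt0.
  - by move: nc; rewrite -(sub1 X v) // cX.
have dn : dot (- d) d != 0 by rewrite dotNl oppr_eq0 gt_eqF.
split; rewrite /vtx_count /edg_count.
  rewrite (_ : [set X | _]%SET = [set face Y d; face Y (- d)]%SET).
    rewrite cards2 (_ : _ != _) //; apply: contraNneq nc => E.
    have [i id] := face_ex d aY.
    have iN : i \in face Y (- d) by rewrite -E.
    have pE k : k \in Y -> p k = p i.
      move=> kY; have [t tE /(_ d)] := dE k i kY (fintype.subsetP (face_sub _ _) i id).
      have -> : dot d (p k) = dot d (p i).
        move: id iN => /faceP[_ /(_ k kY) h1] /faceP[_ /(_ k kY)].
        by rewrite !dotNl lerN2 => h2; apply/eqP; rewrite eq_le h1.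
      rewrite subrr => /esym/eqP; rewrite mulf_eq0 (gt_eqF dd) orbF => /eqP t0.
      by apply/eqP; rewrite -subr_eq0 tE t0 scale0r.
    by apply/constP => k k' kY k'Y; rewrite !pE.
  apply/setP => X; rewrite !inE; apply/andP/orP => [[Xv XY]|].
    by have [->|->] := sub3 X Xv XY; rewrite eqxx; [left|right].
  by case=> /eqP ->; rewrite face_sub fvtx // gt_eqF.
rewrite (_ : [set X | _]%SET = [set Y]%SET) ?cards1 //.
apply/setP => X; rewrite !inE; apply/andP/eqP => [[/asboolP[v [_ Xv ncX _]] XY]|->]; last first.
  by rewrite is_edg_top.
apply: (sub1 X v) => //.
have [i [j [iX jX ij]]] := nconst_ex ncX.
have [t tij /(_ v)] := dE i j (fintype.subsetP XY i iX) (fintype.subsetP XY j jX).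
rewrite Xv in iX jX; rewrite (face_dot iX jX) subrr => /esym/eqP.
rewrite mulf_eq0 => /orP[/eqP t0|/eqP //].
by move: ij; rewrite -subr_eq0 tij t0 scale0r eqxx.
Qed.

Lemma count_le_line u : line (top u) -> vtx_count (top u) = (edg_count (top u)).+1.
Proof.
by have [/count_const[-> ->]|/count_line h /h[-> ->]] := boolP (const (top u)).
Qed.

Lemma sum_nat_bool (T : finType) (P : pred T) :
  \sum_x (P x)%:R = #|[set x | P x]%SET|%:R :> int.
Proof.
rewrite -sum1_card natr_sum [RHS]big_mkcond /=; apply: eq_bigr => x _.
by rewrite inE; case: (P x).
Qed.

(** Both [u] and the perturbed direction are constant on the new face. If it were not collinear they
    would be proportional, and [h] would be a multiple of [u]. *)
Lemma facet_direction u h : u != 0 -> ~ line (top u) -> (forall z, h <> z *: u) ->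
  exists v, face (top u) h = top v /\ line (top v).
Proof.
move=> u0 nl hu; have [x x0 xE] := small_ex (top_perturb u h).
exists (u + x *: h); split=> //; apply: contrapT => nlv.
have [||z] := @normal_unique _ u (u + x *: h) nlv u0.
- move=> i j; rewrite xE => /(fintype.subsetP (face_sub _ _)) iY.
  by move=> /(fintype.subsetP (face_sub _ _)) jY; exact: face_dot iY jY.
- by move=> i j iv jv; exact: face_dot iv jv.
move=> zE; apply: (hu (x^-1 * (z - 1))).
by rewrite -scalerA scalerBl scale1r -zE addrC addKr scalerA mulVf ?scale1r ?gt_eqF.
Qed.

(** Otherwise [v] is a multiple of [u], and [top v] is either the facet itself or disjoint from
    it. *)
Lemma top_normal X u v : u != 0 -> v != 0 -> ~ line (top u) -> X = top v ->
  X \subset top u -> line X -> ~ (forall i j, i \in top u -> j \in top u ->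
  dot v (p i) = dot v (p j)).
Proof.
move=> u0 v0 nl -> XY lX hv.
have [z vz] := normal_unique nl u0 (@face_dot _ _) hv.
have [z0|z0|z0] := ltrgtP z 0.
- have [i iv] := top_ex v; have iu := fintype.subsetP XY i iv.
  move: iv; rewrite vz -[z]opprK scaleNr -scalerN topZ ?oppr_gt0 //.
  by move=> /(top_oppI iu)/eqP; rewrite (negbTE u0).
- by move: lX; rewrite vz topZ.
- by move: v0; rewrite vz z0 scale0r eqxx.
Qed.

(** In a direction that is not a multiple of [u], the facet is supported at a point or a segment,
    where V - E - 1 = 0. Integrate this over the circle of directions modulo [u]: the normal cone of
    a vertex or an edge is a proper sector, of Euler characteristic 1, while the constant 1
    integrates to 0. This leaves V - E = 0. *)
Lemma count_facet u : u != 0 -> ~ line (top u) -> vtx_count (top u) = edg_count (top u) /\ (0 < vtx_count (top u))%N.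
Proof.
move=> u0 nl; set Y := top u; split; last first.
  (* A generic direction separates distinct points, so it selects a vertex of the facet. *)
  have [h hgen] := ex_generic [seq p i - p j | i <- enum 'I_n, j <- enum 'I_n].
  have cF : const (face Y h).
    apply/constP => i j iF jF; apply/eqP; rewrite -subr_eq0.
    apply/negPn/negP => ij; have : dot (p i - p j) h != 0.
      by apply: hgen => //; apply/allpairsP; exists (i, j); rewrite !mem_enum.
    by rewrite dotC dotDr dotNr (face_dot iF jF) subrr eqxx.
  have [x _ xE] := small_ex (top_perturb u h).
  apply/card_gt0P; exists (face Y h); rewrite inE face_sub andbT -xE.
  by apply: is_vtx_top; rewrite xE.
(* Intersecting with [Y] gives every index set a cone that contains the line of [u]; the weight
   [c X] is zero unless [X] lies in [Y]. *)
pose B X := diffs (X :&: Y)%SET Y.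
have BE X h : cone (B X) h = (X :&: Y \subset face Y h)%SET.
  by rewrite cone_diffs // finset.subsetIr.
pose c X : int := (is_vtx X && (X \subset Y))%:R - (is_edg X && (X \subset Y))%:R -
  (X == finset.set0)%:R.
have sumc h : (forall z, h <> z *: u) -> \sum_(X | cone (B X) h) c X = 0.
  move=> /(facet_direction u0 nl)[v [vE lv]].
  transitivity (\sum_X ((is_vtx X && (X \subset top v))%:R -
      (is_edg X && (X \subset top v))%:R - (X == finset.set0)%:R) : int).
    rewrite big_mkcond; apply: eq_bigr => X _; rewrite BE vE /c.
    have [XY|XY] := boolP (X \subset Y).
      rewrite (finset.setIidPl XY) !andbT.
      have [XF|XF] := boolP (X \subset top v); rewrite ?andbT ?andbF //.
      by have [X0|//] := eqVneq X finset.set0; rewrite X0 finset.sub0set in XF.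
    have XF : ~~ (X \subset top v).
      apply: contra XY => /fintype.subset_trans; apply; rewrite -vE; exact: face_sub.
    rewrite (negbTE XF) !andbF (_ : X == _ = false) ?if_same //.
    by apply: contraNF XY => /eqP ->; exact: finset.sub0set.
  rewrite !big_split /= !sumrN !sum_nat_bool -/(vtx_count _) -/(edg_count _) count_le_line //.
  rewrite (_ : [set x | x == finset.set0]%SET = [set finset.set0]%SET) ?cards1 //.
    by rewrite -addn1 natrD; ring.
  by apply/setP => X; rewrite !inE.
have [g g0 gu] := ex_orthogonal u.
have gu0 : cross g u != 0.
  apply/eqP => /(cross_colinear g0)[z uz]; move: gu u0; rewrite uz dotZr => /eqP.
  by rewrite mulf_eq0 dot_eq0 (negbTE g0) orbF => /eqP ->; rewrite scale0r eqxx.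
have [f fgen] := ex_generic (cross g u :: flatten [seq B X | X <- enum {set 'I_n}]).
have ufg : triple u f g != 0 by rewrite tripleC /triple dotC fgen ?mem_head.
have nz (r s : R) : r != 0 -> forall z, r *: g + s *: f <> z *: u.
  by move=> r0 z /(frame_free ufg)/eqP; rewrite (negbTE r0).
have Bwhole X h : (X :&: Y)%SET = finset.set0 -> cone (B X) h.
  by move=> XY; rewrite BE XY finset.sub0set.
have cQ : \sum_(X | `[< exists2 h, cone (B X) h & ~~ cone (B X) (- h) >]) c X = 0.
  (* The weighted sum vanishes at every point of the two lines, so the lists of exceptional points
     are empty. *)
  rewrite (@circle_sum _ _ c B u f g [::] [::] ufg) ?big_nil //.
  - move=> X b /allpairsP[[i j] /= [+ + ->]]; rewrite !mem_enum.
    move=> /(fintype.subsetP (finset.subsetIr _ _)) iY jY.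
    by rewrite dotC dotDr dotNr (face_dot iY jY) subrr.
  - move=> X b bB; apply: fgen; rewrite inE; apply/orP; right.
    by apply/flattenP; exists (B X); rewrite ?map_f ?mem_enum.
  - move=> X; have [XY|/finset.set0Pn[i iXY]] := eqVneq (X :&: Y)%SET finset.set0.
      by left => h; exact: Bwhole.
    right => h; rewrite !BE => /fintype.subsetP/(_ i iXY)/faceP[_ h1].
    move=> /fintype.subsetP/(_ i iXY)/faceP[_ h2].
    apply: normal_unique nl u0 (@face_dot _ _) _.
    suff hE j : j \in Y -> dot h (p j) = dot h (p i) by move=> j k /hE -> /hE ->.
    by move=> jY; apply/eqP; rewrite eq_le h1 //= -lerN2 -!dotNl h2.
  - by move=> s _; apply: sumc => z; have := @nz 1 s (oner_neq0 _) z; rewrite scale1r.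
  - move=> s _; apply: sumc => z; have := @nz (-1) (- s) _ z.
    by rewrite oppr_eq0 oner_neq0 scaleN1r scaleNr -scalerN; apply.
have face_vec X : is_vtx X || is_edg X -> exists v, [/\ v != 0, X = top v & line X].
  case/orP=> /asboolP[v].
    by case=> v0 Xv cX; exists v; split=> //; exact: const_line.
  by case=> v0 Xv _ lX; exists v.
apply/eqP; rewrite -(eqr_nat int) -subr_eq0 -cQ /vtx_count /edg_count -!sum_nat_bool -sumrB.
apply/eqP; rewrite [RHS]big_mkcond; apply: eq_bigr => X _; rewrite /c.
have [X0|X0] := eqVneq X finset.set0.
  rewrite asboolF; last first.
    by move=> [h _]; rewrite Bwhole // X0 finset.set0I.
  suff : ~~ (is_vtx X || is_edg X) by rewrite negb_or => /andP[/negbTE-> /negbTE->].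
  apply/negP => /face_vec[v [_ Xv _]]; have [i] := top_ex v.
  by rewrite -Xv X0 inE.
rewrite /= subr0; have [XY|_] := boolP (X \subset Y); last by rewrite !andbF subrr if_same.
rewrite !andbT; have [/face_vec[v [v0 Xv lX]]|] := boolP (is_vtx X || is_edg X); last first.
  by rewrite negb_or => /andP[/negbTE-> /negbTE->]; rewrite subrr if_same.
rewrite asboolT //; exists v.
  rewrite BE (finset.setIidPl XY) Xv; apply/fintype.subsetP => i iv.
  apply/faceP; split; first by apply: (fintype.subsetP XY); rewrite Xv.
  by move=> j _; move/topP: iv.
rewrite BE (finset.setIidPl XY); apply/negP => XN.
apply: (top_normal u0 v0 nl Xv XY lX); have [i iv] := top_ex v.
have iX : i \in X by rewrite Xv.
have /faceP[_ hN] := fintype.subsetP XN i iX.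
suff hE j : j \in Y -> dot v (p j) = dot v (p i) by move=> j k /hE -> /hE ->.
move=> jY; apply/eqP; rewrite eq_le -[X in _ && X]lerN2 -!dotNl hN // andbT.
by move/topP: iv.
Qed.

(** * The Euler integral over pairs of opposite faces *)

Definition local_defect u : int :=
  (edg_count (top u) * edg_count (top (- u)))%:Z - ((vtx_count (top u))%:Z - 1) * ((vtx_count (top (- u)))%:Z - 1).

(** The numbers (V, E) are (1, 0) for a point, (2, 1) for a segment and (k, k) with k > 0 for a
    facet. A segment opposite to a facet gives k - (k - 1) = 1, and two facets give k k' - (k -
    1)(k' - 1) = k + k' - 1. *)
Lemma local_defect_ge0 u : u != 0 -> 0 <= local_defect u /\
  (local_defect u = 0 <->
   [\/ const (top u), const (top (- u)) | line (top u) /\ line (top (- u))]).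
Proof.
move=> u0; rewrite /local_defect.
have Nu0 : - u != 0 by rewrite oppr_eq0.
have [c1|nc1] := boolP (const (top u)).
  have [-> ->] := count_const c1; rewrite mul0n subrr mul0r subrr; split=> //.
  by split=> // _; constructor 1.
have [c2|nc2] := boolP (const (top (- u))).
  have [-> ->] := count_const c2; rewrite muln0 subrr mulr0 subrr; split=> //.
  by split=> // _; constructor 2.
have [l1|l1] := pselect (line (top u)); have [l2|l2] := pselect (line (top (- u))).
- have [-> ->] := count_line nc1 l1; have [-> ->] := count_line nc2 l2; split=> //.
  by split=> // _; constructor 3.
- have [-> ->] := count_line nc1 l1; have [-> k0] := count_facet Nu0 l2.
  rewrite mul1n (_ : 2%:Z - 1 = 1) // mul1r opprB addrCA subrr addr0; split=> //.
  by split=> //; case=> // -[].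
- have [-> ->] := count_line nc2 l2; have [-> k0] := count_facet u0 l1.
  rewrite muln1 (_ : 2%:Z - 1 = 1) // mulr1 opprB addrCA subrr addr0; split=> //.
  by split=> //; case=> // -[].
- have [-> k0] := count_facet u0 l1; have [-> k1] := count_facet Nu0 l2.
  move: (count_facet u0 l1) => [E1 V1]; move: (count_facet Nu0 l2) => [E2 V2].
  rewrite E1 in V1; rewrite E2 in V2; move: V1 V2.
  move: (edg_count (top u)) (edg_count (top (- u))) => [//|k] [//|k'] _ _.
  have -> : (k.+1 * k'.+1)%:Z - (k.+1%:Z - 1) * (k'.+1%:Z - 1) = (k + k').+1%:Z.
    have S1 m : m.+1%:Z - 1 = m%:Z by rewrite -addn1 PoszD addrK.
    have -> : (k.+1 * k'.+1 = k * k' + (k + k').+1)%N.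
      by rewrite mulSn mulnS addnA addnC addSn (addnC k').
    by rewrite !S1 PoszD PoszM addrAC subrr add0r.
  by split=> //; split=> //; case=> // -[].
Qed.

Definition compat X Y :=
  `[< exists u, [/\ u != 0, X \subset top u & Y \subset top (- u)] >].

(** The empty set lies in every face, so the weights of the subsets of [top u] add up to V(u) -
    1. *)
Definition vtx_weight X : int := (is_vtx X)%:R - (X == finset.set0)%:R.
Definition pair_coef (XY : {set 'I_n} * {set 'I_n}) : int :=
  (is_edg XY.1)%:R * (is_edg XY.2)%:R - vtx_weight XY.1 * vtx_weight XY.2.
Definition pair_ineqs (XY : {set 'I_n} * {set 'I_n}) : seq 'rV[R]_3 :=
  diffs XY.1 finset.setT ++ map -%R (diffs XY.2 finset.setT).

Lemma cone_ineqs XY u : cone (pair_ineqs XY) u = (XY.1 \subset top u) && (XY.2 \subset top (- u)).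
Proof.
rewrite /cone all_cat all_map; congr (_ && _); first by rewrite -[LHS]/(cone _ u) cone_diffs ?finset.subsetT.
rewrite -cone_diffs ?finset.subsetT //; apply: eq_all => a /=.
by rewrite dotNl dotNr.
Qed.

Lemma is_vtx0 : is_vtx finset.set0 = false.
Proof. by apply/negP => /vtx_ex[i]; rewrite inE. Qed.

Lemma is_edg0 : is_edg finset.set0 = false.
Proof.
apply/asboolPn => -[u [_ u0 _ _]]; have [i] := top_ex u.
by rewrite -u0 inE.
Qed.

Lemma sum_pair_coef u : \sum_(XY | cone (pair_ineqs XY) u) pair_coef XY = local_defect u.
Proof.
rewrite (eq_bigl _ _ (cone_ineqs^~ u)).
rewrite -(pair_big (fun X : {set 'I_n} => X \subset top u) (fun Y : {set 'I_n} => Y \subset top (- u))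
  (fun X Y => pair_coef (X, Y))) /= /pair_coef /=.
have sumE v : \sum_(X : {set 'I_n} | X \subset top v) (is_edg X)%:R = (edg_count (top v))%:Z.
  rewrite big_mkcond /edg_count -[RHS]natz -sum_nat_bool; apply: eq_bigr => X _.
  by rewrite andbC; case: (X \subset _).
have sumV v : \sum_(X : {set 'I_n} | X \subset top v) vtx_weight X = (vtx_count (top v))%:Z - 1.
  rewrite sumrB; congr (_ - _).
    rewrite big_mkcond /vtx_count -[RHS]natz -sum_nat_bool; apply: eq_bigr => X _.
    by rewrite andbC; case: (X \subset _).
  rewrite (bigD1 finset.set0) ?finset.sub0set //= eqxx big1 ?addr0 // => X /andP[_].
  by move/negbTE->.
under eq_bigr do rewrite sumrB.
by rewrite sumrB -!big_distrlr !sumE !sumV /= /local_defect PoszM.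
Qed.

(** Ordered pairs replace the unordered ones, which doubles both numbers of pairs. *)
Definition double_defect : int :=
  (#|[set X | is_vtx X]%SET|%:Z - 1) *+ 2 -
  #|[set XY | [&& is_vtx XY.1, is_vtx XY.2 & compat XY.1 XY.2]]%SET|%:Z +
  #|[set XY | [&& is_edg XY.1, is_edg XY.2 & compat XY.1 XY.2]]%SET|%:Z.

Lemma cone_ineqs0 u : cone (pair_ineqs (finset.set0, finset.set0)) u.
Proof. by rewrite cone_ineqs /= !finset.sub0set. Qed.

(** An index in either set is extremal for both [u] and [- u], so [top_oppI] applies. *)
Lemma ineqs_dichotomy XY : XY = (finset.set0, finset.set0) \/
  (forall u, cone (pair_ineqs XY) u -> cone (pair_ineqs XY) (- u) -> u = 0).
Proof.
case: XY => X Y; have [->|/finset.set0Pn[i iX]] := eqVneq X finset.set0; last first.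
  right=> u; rewrite !cone_ineqs /= => /andP[/fintype.subsetP/(_ i iX) h1 _].
  by move=> /andP[/fintype.subsetP/(_ i iX) h2 _]; exact: top_oppI h1 h2.
have [->|/finset.set0Pn[i iY]] := eqVneq Y finset.set0; last first.
  right=> u; rewrite !cone_ineqs opprK /= => /andP[_ /fintype.subsetP/(_ i iY) h1].
  by move=> /andP[_ /fintype.subsetP/(_ i iY) h2]; exact: top_oppI h2 h1.
by left.
Qed.

Lemma whole_ineqs XY :
  `[< forall u, cone (pair_ineqs XY) u >] = (XY == (finset.set0, finset.set0)).
Proof.
apply/asboolP/eqP => [W|-> u]; last exact: cone_ineqs0.
have [//|pt] := ineqs_dichotomy XY; have [o /eqP[]] := ex_orthogonal (0 : 'rV[R]_3).
exact: pt.
Qed.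

Lemma proper_ineqs X Y :
  `[< exists2 u, cone (pair_ineqs (X, Y)) u & ~~ cone (pair_ineqs (X, Y)) (- u) >] =
  compat X Y && ((X, Y) != (finset.set0, finset.set0)).
Proof.
apply/asboolP/andP => [[u cu cNu]|[/asboolP[u [u0 uX uY]] XY]].
  split; last by apply: contraNneq cNu => ->; exact: cone_ineqs0.
  apply/asboolP; exists u; move: cu; rewrite cone_ineqs /= => /andP[uX uY]; split=> //.
  by apply: contraNneq cNu => ->; rewrite oppr0 cone0.
have cu : cone (pair_ineqs (X, Y)) u by rewrite cone_ineqs /= uX.
exists u => //; apply/negP => cNu; have [XY0|/(_ u cu cNu)/eqP] := ineqs_dichotomy (X, Y).
  by rewrite XY0 eqxx in XY.
by rewrite (negbTE u0).
Qed.

Lemma compatC X Y : compat X Y = compat Y X.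
Proof.
by apply: asbool_equiv_eq; split=> -[u [u0 h1 h2]]; exists (- u);
  rewrite oppr_eq0 opprK.
Qed.

Lemma compat0 X : is_vtx X -> compat X finset.set0.
Proof.
by move=> /asboolP[u [u0 -> _]]; apply/asboolP; exists u; rewrite finset.sub0set.
Qed.

(** Expand the product of the two weights. A vertex paired with the empty set has coefficient 1 and
    its cone is always proper, which gives V twice; the pair of empty sets has coefficient -1 and
    counts doubly. *)
Lemma double_defectE :
  \sum_(XY | `[< exists2 u, cone (pair_ineqs XY) u & ~~ cone (pair_ineqs XY) (- u) >]) pair_coef XY +
  (\sum_(XY | `[< forall u, cone (pair_ineqs XY) u >]) pair_coef XY) *+ 2 = double_defect.
Proof.
rewrite (eq_bigl _ _ whole_ineqs) big_pred1_eq.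
have -> : pair_coef (finset.set0, finset.set0) = -1 by rewrite /pair_coef /vtx_weight /= is_edg0 is_vtx0 eqxx.
pose V0 (XY : {set 'I_n} * {set 'I_n}) := is_vtx XY.1 && (XY.2 == finset.set0).
pose V1 (XY : {set 'I_n} * {set 'I_n}) := (XY.1 == finset.set0) && is_vtx XY.2.
have -> : \sum_(XY | `[< exists2 u, cone (pair_ineqs XY) u & ~~ cone (pair_ineqs XY) (- u) >]) pair_coef XY =
    \sum_XY (([&& is_edg XY.1, is_edg XY.2 & compat XY.1 XY.2])%:R -
    ([&& is_vtx XY.1, is_vtx XY.2 & compat XY.1 XY.2])%:R + (V0 XY)%:R + (V1 XY)%:R) :> int.
  rewrite big_mkcond; apply: eq_bigr => -[X Y] _; rewrite /V0 /V1 /pair_coef /vtx_weight proper_ineqs /=.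
  rewrite xpair_eqE; have [->|X0] := eqVneq X finset.set0; have [->|Y0] := eqVneq Y finset.set0;
    rewrite ?is_edg0 ?is_vtx0 ?andbF ?andbT //=.
  - rewrite compatC mul0r !subr0 !sub0r mulN1r opprK !add0r.
    by have [/compat0 ->|_] := boolP (is_vtx Y); rewrite ?if_same.
  - rewrite mulr0 !subr0 !sub0r mulrN1 opprK ?add0r ?addr0.
    by have [/compat0 ->|_] := boolP (is_vtx X); rewrite ?if_same.
  - by case: (compat X Y); case: (is_vtx X); case: (is_vtx Y); case: (is_edg X);
      case: (is_edg Y).
rewrite !big_split /= sumrN !sum_nat_bool /double_defect !natz.
have -> : #|[set XY | V0 XY]%SET| = #|[set X | is_vtx X]%SET|.
  rewrite -[RHS]muln1 -(cards1 (finset.set0 : {set 'I_n})) -cardsX; apply: eq_card => -[X Y].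
  by rewrite !inE.
have -> : #|[set XY | V1 XY]%SET| = #|[set X | is_vtx X]%SET|.
  rewrite -[RHS]mul1n -(cards1 (finset.set0 : {set 'I_n})) -cardsX; apply: eq_card => -[X Y].
  by rewrite !inE.
by rewrite mulrnDl mulr2n; ring.
Qed.

Lemma double_defect_eq0 : double_defect = 0 <-> forall u, u != 0 ->
  [\/ const (top u), const (top (- u)) | line (top u) /\ line (top (- u))].
Proof.
(* One nonzero direction for each index set of the form [top u] with [u] nonzero, and 0 for the
   others. A facet determines its normal up to a factor, so these directions cover all facets. *)
pose U := [seq xget 0 [set u | u != 0 /\ top u = X] | X <- enum {set 'I_n}].
have UP u : u != 0 -> ~ line (top u) -> exists2 w, w \in U & exists z, u = z *: w.
  move=> u0 nl; exists (xget 0 [set v | v != 0 /\ top v = top u]).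
    by apply: (map_f (fun X => xget 0 [set v | v != 0 /\ top v = X])); rewrite mem_enum.
  have [] := @xgetI _ 0 [set v | v != 0 /\ top v = top u] u (conj u0 erefl).
  set w := xget _ _ => w0 wE; rewrite -wE in nl.
  apply: normal_unique nl w0 (@face_dot _ _) _; rewrite wE; exact: face_dot.
have dich XY : (forall u, cone (pair_ineqs XY) u) \/
    (forall u, cone (pair_ineqs XY) u -> cone (pair_ineqs XY) (- u) -> u = 0).
  by have [->|] := ineqs_dichotomy XY; [left; exact: cone_ineqs0|right].
have supp u : u != 0 -> \sum_(XY | cone (pair_ineqs XY) u) pair_coef XY != 0 ->
    exists2 w, w \in U & exists z, u = z *: w.
  move=> u0; rewrite sum_pair_coef => /eqP nz.
  have [l1|] := pselect (line (top u)); last exact: UP.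
  have [l2|nl2] := pselect (line (top (- u))).
    by case: nz; apply/(local_defect_ge0 u0).2; constructor 3.
  have [|w wU [z uz]] := UP (- u) _ nl2; first by rewrite oppr_eq0.
  by exists w => //; exists (- z); rewrite scaleNr -uz opprK.
have key g (g0 : g != 0) := sphere_sum dich supp g0.
rewrite -double_defectE; split=> [D0 u u0|H].
  (* With [g := u], the list [L] contains [u] if the integrand is nonzero there. A sum of
     nonnegative terms is zero only if each term is. *)
  have [L [Lnz Lu]] := key u u0; rewrite D0 => /esym/eqP.
  rewrite big_seq psumr_eq0 => [/allP L0|v /Lnz v0]; last first.
    by rewrite sum_pair_coef; case: (local_defect_ge0 v0).
  apply/(local_defect_ge0 u0).2; rewrite -sum_pair_coef; apply/eqP/negPn/negP => nz.
  by move: (L0 u (Lu nz)); rewrite /= Lu // (negbTE nz).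
(* Only a nonzero vector is wanted here. *)
have [o o0 _] := ex_orthogonal (0 : 'rV[R]_3).
have [L [Lnz _ ->]] := key o o0.
rewrite big_seq big1 // => v /Lnz v0; rewrite sum_pair_coef.
by apply/(local_defect_ge0 v0).2/H.
Qed.

End Faces.

(** * Counting unordered pairs through ordered ones *)

Section Counting.

Lemma card_image_fin (I : finType) (T : choiceType) (O : {set I}) (f : I -> T) :
  {in O &, injective f} -> Defs.card (f @` [set` O]) = #|O|.
Proof.
move=> inj; have [F FE FO] : exists2 F : {fset T}, F =i map f (enum O) & #|` F|%fset = #|O|.
  exists (seq_fset tt (map f (enum O))); first exact: seq_fsetE.
  rewrite size_seq_fset undup_id ?size_map ?cardE //.
  by rewrite map_inj_in_uniq ?enum_uniq // => i j; rewrite !mem_enum; exact: inj.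
rewrite /Defs.card (_ : f @` _ = [set` F]) ?set_fsetK //.
apply/seteqP; split=> x /=; rewrite FE.
  by move=> [i iO <-]; rewrite map_f // mem_enum.
by move=> /mapP[i]; rewrite mem_enum => iO ->; exists i.
Qed.

Lemma card_unordered_pairs (I : finType) (T : choiceType) (O : {set I}) (f : I -> T)
    (r : rel I) (rT : T -> T -> Prop) :
  {in O &, injective f} -> {in O &, forall i j, rT (f i) (f j) <-> r i j} ->
  symmetric r -> {in O, forall i, r i i = false} ->
  (Defs.card (unordered_pairs (f @` [set` O]) rT)).*2 =
  #|[set ij | [&& ij.1 \in O, ij.2 \in O & r ij.1 ij.2]]%SET|.
Proof.
move=> inj rTE rC rI.
pose S := [set ij | [&& ij.1 \in O, ij.2 \in O & r ij.1 ij.2]]%SET.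
(* The enumeration order picks one of the two orderings of each pair; [S] is then the disjoint union
   of [S1] and its mirror image. *)
pose lt (ij : I * I) := (enum_rank ij.1 < enum_rank ij.2)%N.
pose S1 := [set ij in S | lt ij]%SET.
pose g ij := [set f ij.1; f ij.2].
have -> : unordered_pairs (f @` [set` O]) rT = g @` [set` S1].
  apply/seteqP; split=> e /=.
    move=> [x [y [[i iO <-] [j jO <-] ij /rTE r_ij ->]]].
    have rij := r_ij iO jO; case: (ltngtP (enum_rank i) (enum_rank j)) => lij.
    - by exists (i, j) => //=; rewrite !inE /= iO jO rij.
    - by exists (j, i); [rewrite !inE /= iO jO rC rij|rewrite /g /= setUC].
    - by case: ij; move/val_inj/enum_rank_inj: lij => ->.
  move=> [[i j]]; rewrite !inE /= => /andP[/and3P[iO jO rij] _] <-.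
  exists (f i), (f j); split=> //; last exact/rTE.
  by move=> /inj ij; move: rij; rewrite ij // rI.
rewrite card_image_fin; last first.
  move=> [i j] [i' j']; rewrite !inE /lt /= => /andP[/and3P[iO jO rij] lij].
  move=> /andP[/and3P[i'O j'O rij'] lij'] /seteqP[s1 s2].
  have [/= /inj ii|/= /inj ij'] := s1 _ (or_introl erefl).
    have [/= /inj ji|/= /inj jj] := s1 _ (or_intror erefl).
      by move: rij; rewrite ii // ji // rI.
    by rewrite ii // jj.
  have [/= /inj ji|/= /inj jj] := s1 _ (or_intror erefl); last first.
    by move: rij; rewrite ij' // jj // rI.
  by move: lij; rewrite ij' // ji // ltnNge ltnW.
pose sw (ij : I * I) := (ij.2, ij.1).
have sw_inj : injective sw by move=> [i j] [i' j'] [-> ->].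
rewrite -[RHS]/(#|S|); have <- : S1 :|: sw @: S1 = S.
  apply/setP => -[i j]; rewrite finset.in_setU !inE /=; apply/orP/idP.
    case=> [/andP[]//|/imsetP[[i' j']]]; rewrite !inE /= => /andP[/and3P[iO jO rij] _].
    by move=> [-> ->]; rewrite iO jO rC.
  move=> /and3P[iO jO rij]; rewrite iO jO rij /= /lt /=.
  case: (ltngtP (enum_rank i) (enum_rank j)) => lij; [by left| |].
    right; apply/imsetP; exists (j, i) => //; by rewrite !inE /= iO jO rC rij.
  by move/val_inj/enum_rank_inj: lij rij => ->; rewrite rI.
rewrite cardsU card_imset // (_ : _ :&: _ = finset.set0) ?cards0 ?subn0 ?addnn //.
apply/setP => -[i j]; rewrite !inE; apply/negP => /andP[/andP[_ lij] /imsetP[[i' j']]].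
rewrite !inE => /andP[_ lij'] [ii jj]; move: lij lij'; rewrite /lt /= ii jj => lij.
by rewrite ltnNge ltnW.
Qed.

End Counting.

(** * Convex hulls of subfamilies and support faces *)

Section Hull.
Variables (R : realType) (n : nat) (p : 'I_n -> 'rV[R]_3).
Implicit Types (u v x y : 'rV[R]_3) (X Y : {set 'I_n}) (i j : 'I_n).

Definition sub_hull X : set 'rV[R]_3 :=
  [set x | exists w : 'I_n -> R, [/\ forall i, 0 <= w i, \sum_i w i = 1,
     forall i, i \notin X -> w i = 0 & x = \sum_i w i *: p i]].

Let P := convex_hull p.

Lemma sub_hull_sub X x : sub_hull X x -> P x.
Proof. by move=> [w [w0 w1 _ ->]]; exists w. Qed.

Lemma sub_hull_pt X i : i \in X -> sub_hull X (p i).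
Proof.
move=> iX; exists (fun j => (j == i)%:R); split.
- by move=> j; rewrite ler0n.
- by rewrite (bigD1 i) //= eqxx big1 ?addr0 // => j /negbTE ->.
- by move=> j; apply: contraNeq; rewrite pnatr_eq0 eqb0 negbK => /eqP ->.
- rewrite (bigD1 i) //= eqxx scale1r big1 ?addr0 // => j /negbTE ->.
  by rewrite scale0r.
Qed.

Lemma hull_pt i : P (p i).
Proof. by apply: (@sub_hull_sub [set: 'I_n]%SET); apply: sub_hull_pt; rewrite finset.in_setT. Qed.

Lemma sub_hull_ex X x : sub_hull X x -> exists i, i \in X.
Proof.
move=> [w [_ w1 wX _]]; apply/finset.set0Pn; apply/negP => /eqP X0.
move/eqP: w1; rewrite big1 ?(eq_sym 0) ?oner_eq0 // => i _.
by rewrite wX // X0 inE.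
Qed.

Lemma sub_hull_setT x : P x -> sub_hull [set: 'I_n]%SET x.
Proof. by move=> [w [w0 w1 ->]]; exists w; split=> // i; rewrite finset.in_setT. Qed.

Lemma dot_sub_hull_le X u (c : R) x : (forall i, i \in X -> dot u (p i) <= c) ->
  sub_hull X x -> dot u x <= c.
Proof.
move=> h [w [w0 w1 wX ->]]; rewrite dot_sumr -[leRHS]mul1r -w1 mulr_suml.
apply: ler_sum => i _; rewrite dotZr; have [/h iX|/wX->] := boolP (i \in X).
  by rewrite ler_wpM2l.
by rewrite !mul0r.
Qed.

Lemma dot_sub_hull X u (c : R) x : (forall i, i \in X -> dot u (p i) = c) ->
  sub_hull X x -> dot u x = c.
Proof.
move=> h [w [_ w1 wX ->]]; rewrite dot_sumr -[RHS]mul1r -w1 mulr_suml.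
apply: eq_bigr => i _; rewrite dotZr; have [/h->//|/wX->] := boolP (i \in X).
by rewrite !mul0r.
Qed.

Lemma support_faceP u i x : i \in top p u ->
  support_face P u x <-> P x /\ dot u x = dot u (p i).
Proof.
move=> iu; have le y : P y -> dot u y <= dot u (p i) by move/sub_hull_setT; apply: dot_sub_hull_le => j _; exact/topP.
split=> -[Px h]; split=> //; last by move=> y /le; rewrite h.
by apply/eqP; rewrite eq_le le //= h //; exact: hull_pt.
Qed.

Lemma support_face_pt u i : support_face P u (p i) <-> i \in top p u.
Proof.
split=> [[_ h]|iu]; last by apply/(support_faceP _ iu); split=> //; exact: hull_pt.
by apply/topP => j; apply: h; exact: hull_pt.
Qed.

(** At a maximal convex combination the weighted gaps to the maximum are nonnegative and add up to
    0, so the weight of every index that is not maximal vanishes. *)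
Lemma support_faceE u (i0 : 'I_n) : support_face P u = sub_hull (top p u).
Proof.
have [i iu] := top_ex p i0 u.
apply/seteqP; split=> x; rewrite (support_faceP _ iu); last first.
  move=> hx; split; first exact: sub_hull_sub hx.
  by apply: dot_sub_hull hx => j ju; exact: face_dot ju iu.
move=> [[w [w0 w1 ->]] E]; exists w; split=> // j; apply: contraNeq => wj.
have D0 k : 0 <= w k * (dot u (p i) - dot u (p k)).
  by rewrite mulr_ge0 // subr_ge0; move/topP: iu.
have : \sum_k w k * (dot u (p i) - dot u (p k)) = 0.
  under eq_bigr do rewrite mulrBr.
  rewrite sumrB -mulr_suml w1 mul1r -E dot_sumr.
  by under eq_bigr do rewrite dotZr; rewrite subrr.
move/eqP; rewrite psumr_eq0 // => /allP/(_ j (mem_index_enum j)).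
rewrite /= mulf_eq0 (negbTE wj) subr_eq0 /= => /eqP ij.
by apply: face_eqdot iu _ ij; rewrite finset.in_setT.
Qed.

Lemma sub_hull_const X i x : const p X -> i \in X -> sub_hull X x -> x = p i.
Proof.
move=> /constP cX iX [w [_ w1 wX ->]]; rewrite -[RHS]scale1r -w1 scaler_suml.
apply: eq_bigr => j _; have [jX|/wX->] := boolP (j \in X); last by rewrite !scale0r.
by rewrite (cX j i).
Qed.

Lemma sub_hull_submx X i m (A : 'M[R]_(m, 3)) x :
  (forall j, j \in X -> (p j - p i <= A)%MS) -> sub_hull X x -> (x - p i <= A)%MS.
Proof.
move=> h [w [_ w1 wX ->]].
have -> : \sum_j w j *: p j - p i = \sum_j w j *: (p j - p i).
  by under [RHS]eq_bigr do rewrite scalerBr; rewrite sumrB -scaler_suml w1 scale1r.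
apply: summx_sub => j _; have [/h|/wX->] := boolP (j \in X); last by rewrite scale0r sub0mx.
exact: scalemx_sub.
Qed.

Lemma sub_hull_convex X x y (t : R) : 0 <= t <= 1 -> sub_hull X x -> sub_hull X y ->
  sub_hull X ((1 - t) *: x + t *: y).
Proof.
move=> /andP[t0 t1] [w [w0 w1 wX ->]] [w' [w'0 w'1 w'X ->]].
exists (fun i => (1 - t) * w i + t * w' i); split.
- by move=> i; rewrite addr_ge0 // mulr_ge0 // subr_ge0.
- by rewrite big_split /= -!mulr_sumr w1 w'1 !mulr1 subrK.
- by move=> i iX; rewrite wX // w'X // !mulr0 addr0.
- rewrite !scaler_sumr -big_split; apply: eq_bigr => i _ /=.
  by rewrite [RHS]scalerDl !scalerA.
Qed.

Lemma sub_hull_mono X Y x : X \subset Y -> sub_hull X x -> sub_hull Y x.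
Proof.
move=> XY [w [w0 w1 wX ->]]; exists w; split=> // i iY.
by apply: wX; apply: contra iY; exact: (fintype.subsetP XY).
Qed.

Lemma sub_hull_top_inj u v : sub_hull (top p u) = sub_hull (top p v) -> top p u = top p v.
Proof.
move=> E; apply/setP => i; rewrite -[LHS]/(i \in top p u).
have e w : sub_hull (top p w) (p i) <-> i \in top p w.
  rewrite -support_faceE //; exact: support_face_pt.
by apply/idP/idP; [move=> /e; rewrite E => /e|move=> /e; rewrite -E => /e].
Qed.

End Hull.

(** * Affine dimension of a point *)

Section AffineDimension.
Variables (R : realType).
Implicit Types (S : set 'rV[R]_3).

Lemma row_free_row0 d (A : 'M[R]_(d.+1, 3)) : row_free A -> row ord0 A != 0.
Proof.
move=> fA; apply/eqP => r0.
have /(row_free_inj fA) : delta_mx 0 0 *m A = (0 : 'rV_(d.+1)) *m A.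
  by rewrite -rowE r0 mul0mx.
by move/rowP/(_ 0); rewrite !mxE !eqxx => /eqP; rewrite oner_eq0.
Qed.

Lemma affine_dim_set1 (v : 'rV[R]_3) : has_affine_dim [set v] 0.
Proof.
exists v, 0; split=> //; [|by case|by move=> x ->; rewrite subrr sub0mx].
by rewrite /row_free -leqn0 rank_leq_row.
Qed.

Lemma affine_dim_set1_eq0 (v : 'rV[R]_3) d : has_affine_dim [set v] d -> d = 0%N.
Proof.
case: d => // d [x [A [-> /row_free_row0/eqP r0 /(_ ord0) /= h _]]]; case: r0.
by apply: (addrI v); rewrite addr0.
Qed.

End AffineDimension.

(** * From index sets to vertices, edges and facets of the polyhedron *)

Section Polyhedron.
Variables (R : realType) (n : nat) (p : 'I_n -> 'rV[R]_3).
Implicit Types (u v x y d : 'rV[R]_3) (X Y : {set 'I_n}) (i j : 'I_n).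
Hypothesis full : forall u, (forall i j, dot u (p i) = dot u (p j)) -> u = 0.
Variable i0 : 'I_n.

Let P := convex_hull p.

Lemma line_sub X d i : (forall j k, j \in X -> k \in X -> exists t, p j - p k = t *: d) ->
  i \in X -> forall j, j \in X -> (p j - p i <= d)%MS.
Proof. by move=> h iX j jX; have [t ->] := h j i jX iX; rewrite scalemx_sub. Qed.

Lemma affine_dim1 X : ~~ const p X -> line p X -> has_affine_dim (sub_hull p X) 1.
Proof.
move=> /nconst_ex[i [j [iX jX ij]]] [d hd]; exists (p i), (p j - p i).
have [s hs] := hd j i jX iX.
have s0 : s != 0.
  by apply: contraNneq ij => s0; rewrite eq_sym -subr_eq0 hs s0 scale0r.
split.
- exact: sub_hull_pt.
- by rewrite -row_leq_rank lt0n mxrank_eq0 subr_eq0 eq_sym.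
- by move=> k; rewrite row_id addrC subrK; exact: sub_hull_pt.
- move=> x hx; apply: sub_hull_submx hx => k kX; have [t ->] := hd k i kX iX.
  by rewrite hs -(divfK s0 t) -scalerA scalemx_sub.
Qed.

Lemma affine_dim_not_const X m : has_affine_dim (sub_hull p X) m.+1 -> ~~ const p X.
Proof.
move=> [x [A [hx fA hA _]]]; have [i iX] := sub_hull_ex hx.
apply/negP => cX; move/row_free_row0: fA => /eqP; apply.
apply: (addrI x); rewrite addr0.
by rewrite (sub_hull_const cX iX (hA ord0)) (sub_hull_const cX iX hx).
Qed.

Lemma affine_dim1_line X : has_affine_dim (sub_hull p X) 1 -> line p X.
Proof.
move=> [x [A [_ _ _ hA]]]; exists A => i j iX jX.
have [/sub_rVP[s hs] /sub_rVP[t ht]] := (hA _ (sub_hull_pt p iX), hA _ (sub_hull_pt p jX)).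
by exists (s - t); rewrite scalerBl -hs -ht opprB addrA subrK.
Qed.

Lemma affine_dim2_not_line X (F : set 'rV[R]_3) : has_affine_dim F 2 ->
  F `<=` sub_hull p X -> ~ line p X.
Proof.
move=> [x [A [hx fA hA _]]] FX [d hd].
have [i iX] := sub_hull_ex (FX _ hx).
have sub y : F y -> (y - p i <= d)%MS.
  by move=> /FX; apply: sub_hull_submx; exact: line_sub.
have : (A <= d)%MS.
  apply/row_subP => k; rewrite -(addKr x (row k A)).
  rewrite (_ : - x + _ = (x + row k A - p i) - (x - p i)).
    by rewrite addmx_sub ?eqmx_opp ?sub //; exact: hA.
  by apply/rowP => a; rewrite !mxE; ring.
by move/mxrankS; rewrite (eqP fA) => /leq_trans/(_ (rank_leq_row d)).
Qed.

(** Being non-collinear, the face has two independent differences. All its differences are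
    orthogonal to [u], hence lie in a plane, which these two span. *)
Lemma affine_dim2 u : u != 0 -> ~ line p (top p u) ->
  has_affine_dim (sub_hull p (top p u)) 2.
Proof.
move=> u0 nl; set X := top p u in nl *.
have [|i [j [iX jX ij]]] := @nconst_ex _ _ p X.
  by apply/negP => /const_line.
have [k kX nk] : exists2 k, k \in X & ~ (p k - p i <= p j - p i)%MS.
  apply: contrapT => H; apply: nl; exists (p j - p i) => a b aX bX.
  have sub c : c \in X -> (p c - p i <= p j - p i)%MS.
    by move=> cX; apply: contrapT => nc; apply: H; exists c.
  have [/sub_rVP[s hs] /sub_rVP[t ht]] := (sub a aX, sub b bX).
  by exists (s - t); rewrite scalerBl -hs -ht opprB addrA subrK.
pose A := col_mx (p j - p i) (p k - p i) : 'M[R]_(1 + 1, 3).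
have ker_dot x : (x <= kermx u^T)%MS = (dot x u == 0).
  have -> : dot x u = (x *m u^T) 0 0 by rewrite mxE; apply: eq_bigr => l _; rewrite mxE.
  apply/sub_kermxP/eqP => [->|x0]; first by rewrite mxE.
  by apply/matrixP => a b; rewrite !ord1 x0 mxE.
have iA : ((p j - p i)%R <= A)%MS.
  by rewrite -addsmxE addsmxSl.
have rA : \rank A = 2.
  apply/eqP; rewrite eqn_leq rank_leq_row.
  have /rank_ltmx : ((p j - p i)%R < A)%MS.
    rewrite ltmxE iA; apply/negP => Ai; apply: nk; apply: submx_trans Ai.
    by rewrite -addsmxE addsmxSr.
  by rewrite rank_rV subr_eq0 eq_sym ij.
have dX a b : a \in X -> b \in X -> dot (p a - p b) u = 0.
  by move=> aX bX; rewrite dotC dotDr dotNr (face_dot aX bX) subrr.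
have AK : (A <= kermx u^T)%MS.
  by rewrite col_mx_sub !ker_dot !dX // eqxx.
have KA : (kermx u^T <= A)%MS.
  by rewrite -(geq_leqif (mxrank_leqif_sup AK)) mxrank_ker mxrank_tr rank_rV u0 rA.
exists (p i), A; split.
- exact: sub_hull_pt.
- by rewrite /row_free rA.
- move=> l; rewrite -(@splitK 1 1 l); case: (@fintype.split 1 1 l) => l' /=.
    have -> : row (lshift 1 l') A = p j - p i by rewrite /A rowKu row_id.
    by rewrite addrC subrK; exact: sub_hull_pt.
  have -> : row (rshift 1 l') A = p k - p i by rewrite /A rowKd row_id.
  by rewrite addrC subrK; exact: sub_hull_pt.
- move=> x hx; apply: submx_trans KA; rewrite ker_dot dotDl dotNl !(dotC _ u) subr_eq0.
  by apply/eqP; apply: dot_sub_hull hx => l lX; exact: face_dot lX iX.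
Qed.

Lemma faceE u : support_face P u = sub_hull p (top p u).
Proof. exact: support_faceE. Qed.

Lemma antipodal_supportP x y :
  antipodal P x y <-> exists u, [/\ u != 0, support_face P u x & support_face P (- u) y].
Proof.
split=> [[Px Py [u [a [b [u0 ua ub hz]]]]]|[u [u0 [Px hx] [Py hy]]]].
  exists u; split=> //; split=> // z /hz /andP[h1 h2]; first by rewrite ua.
  by rewrite !dotNl lerN2 ub.
split=> //; exists u, (dot u x), (dot u y); split=> // z Pz.
by rewrite hx // andbT -lerN2 -!dotNl hy.
Qed.

(** The common point of a [const] set; the default 0 is reached only by the empty set. *)
Definition pt X := if [pick i in X] is Some i then p i else 0.

Lemma ptE X i : const p X -> i \in X -> pt X = p i.
Proof.
move=> /constP cX iX; rewrite /pt; case: pickP => [j jX|/(_ i)]; first exact: cX.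
by rewrite /= iX.
Qed.

Lemma vtxP X : is_vtx p X -> exists i, [/\ i \in X, pt X = p i,
  forall u, support_face P u (pt X) <-> X \subset top p u & const p X].
Proof.
move=> Xv; have [i iX] := vtx_ex i0 Xv; move/asboolP: Xv => [v [_ Xv cX]].
exists i; split=> //; rewrite (ptE cX iX) // => u; split=> [/support_face_pt iu|XU].
  apply/fintype.subsetP => j jX; have /constP/(_ i j iX jX) ij := cX.
  by apply: face_eqdot iu _ _; rewrite ?finset.in_setT // ij.
by apply/support_face_pt; exact: (fintype.subsetP XU).
Qed.

Lemma support_face_vtx u : const p (top p u) -> support_face P u = [set pt (top p u)].
Proof.
move=> cu; have [i iu] := top_ex p i0 u; rewrite faceE (ptE cu iu).
apply/seteqP; split=> x /=; first exact: sub_hull_const.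
by move=> ->; exact: sub_hull_pt.
Qed.

Lemma vertices_image : [set v | is_vertex P v] = pt @` [set` [set X | is_vtx p X]%SET].
Proof.
apply/seteqP; split=> v /=.
  move=> [[u u0 vE] _]; rewrite faceE in vE.
  have hv i : i \in top p u -> p i = v.
    by move=> /(sub_hull_pt p); rewrite -vE.
  have cu : const p (top p u) by apply/constP => i j /hv -> /hv ->.
  have [i iu] := top_ex p i0 u; exists (top p u); last by rewrite (ptE cu iu) hv.
  by rewrite !finset.in_set; exact: is_vtx_top.
move=> [X]; rewrite !finset.in_set => /asboolP[u [u0 -> cu]] <-; split; last exact: affine_dim_set1.
by exists u => //; rewrite support_face_vtx.
Qed.

Lemma pt_inj : {in [set X | is_vtx p X]%SET &, injective pt}.
Proof.
move=> X Y; rewrite !finset.in_set => Xv Yv; have [i [iX -> Xs cX]] := vtxP Xv.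
have [j [jY ptY Ys cY]] := vtxP Yv; rewrite ptY => ij.
apply: (vtx_sub_const i0 Xv _ cY); move: (Yv) => /asboolP[u [_ YE _]].
rewrite YE; apply/Xs; rewrite ij; apply/support_face_pt.
by rewrite -YE.
Qed.

Lemma antipodal_pt X Y : is_vtx p X -> is_vtx p Y -> antipodal P (pt X) (pt Y) <-> compat p X Y.
Proof.
move=> /vtxP[i [_ _ Xs _]] /vtxP[j [_ _ Ys _]]; rewrite antipodal_supportP.
split=> [[u [u0 /Xs h1 /Ys h2]]|/asboolP[u [u0 /Xs h1 /Ys h2]]]; last by exists u.
by apply/asboolP; exists u.
Qed.

Lemma compat_irr X i : i \in X -> compat p X X = false.
Proof.
move=> iX; apply/asboolP => -[u [u0 /fintype.subsetP/(_ i iX) h1 /fintype.subsetP/(_ i iX) h2]].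
by move: u0; rewrite (top_oppI full h1 h2) eqxx.
Qed.

Lemma edges_image : [set E | is_edge P E] = sub_hull p @` [set` [set X | is_edg p X]%SET].
Proof.
apply/seteqP; split=> E /=.
  move=> [[u u0 ->]]; rewrite faceE => dim1; exists (top p u) => //; rewrite !finset.in_set.
  by apply: is_edg_top => //; [exact: affine_dim_not_const dim1|exact: affine_dim1_line].
move=> [X]; rewrite !finset.in_set => /asboolP[u [u0 -> nc lu]] <-; split; last exact: affine_dim1.
by exists u => //; rewrite faceE.
Qed.

Lemma sub_hull_inj : {in [set X | is_edg p X]%SET &, injective (sub_hull p)}.
Proof.
move=> X Y; rewrite !finset.in_set => /asboolP[u [_ -> _ _]] /asboolP[v [_ -> _ _]].
exact: sub_hull_top_inj.
Qed.

Lemma edge_segment X : ~~ const p X -> line p X -> exists a b, sub_hull p X = segment a b.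
Proof.
move=> /nconst_ex[i1 [j1 [iX1 jX1 ij1]]] [d hd].
(* The indices [i] and [j] give the two ends of the edge, extremal along [d]. *)
have [i /faceP[iX ilo]] := face_ex p (- d) iX1.
have [j /faceP[jX jhi]] := face_ex p d iX1.
have lo k : k \in X -> dot d (p i) <= dot d (p k).
  by move=> /ilo; rewrite !dotNl lerN2.
have d0 : d != 0.
  apply: contraNneq ij1 => d0; have [t] := hd _ _ iX1 jX1.
  by rewrite d0 scaler0 => /eqP; rewrite subr_eq0.
have dd : 0 < dot d d by rewrite dot_gt0.
have [s hs] := hd j i jX iX.
have tE k t : p k - p i = t *: d -> dot d (p k) - dot d (p i) = t * dot d d.
  by move=> h; rewrite -dotNr -dotDr h dotZr.
have s0 : s != 0.
  apply: contraNneq ij1 => s0.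
  have pE k : k \in X -> p k = p i.
    move=> kX; have [t ht] := hd k i kX iX; have := tE _ _ ht; have := tE _ _ hs.
    have := lo k kX; have := jhi k kX; rewrite s0 mul0r => h1 h2 h3 h4.
    have : t * dot d d == 0 by apply/eqP; lra.
    rewrite mulf_eq0 (gt_eqF dd) orbF => /eqP t0.
    by apply/eqP; rewrite -subr_eq0 ht t0 scale0r.
  by rewrite !pE.
exists (p i), (p j); apply/seteqP; split=> x; last first.
  by move=> [t t01 ->]; apply: sub_hull_convex => //; exact: sub_hull_pt.
move=> hx.
have /sub_rVP[q hq] : (x - p i <= p j - p i)%MS.
  apply: sub_hull_submx hx => k kX; have [t ->] := hd k i kX iX.
  by rewrite hs -(divfK s0 t) -scalerA scalemx_sub.
exists q; last first.
  have -> : x = p i + q *: (p j - p i) by rewrite -hq addrC subrK.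
  by rewrite scalerBr scalerBl scale1r addrA addrAC.
have h1 := dot_sub_hull_le jhi hx.
have h2 : dot (- d) x <= dot (- d) (p i).
  exact: dot_sub_hull_le ilo hx.
have h3 := tE _ _ hs.
have h4 : dot d x - dot d (p i) = q * (s * dot d d).
  by rewrite -dotNr -dotDr hq dotZr hs dotZr.
have spos : 0 < s * dot d d.
  rewrite lt_def -{2}h3 subr_ge0 lo // andbT.
  by rewrite mulf_neq0 // gt_eqF.
move: h2; rewrite !dotNl lerN2 => h2; rewrite -(ler_pM2r spos) -[q <= 1](ler_pM2r spos).
by rewrite mul0r mul1r -h4 -h3 subr_ge0 h2 lerD2r h1.
Qed.

Lemma edgP X : is_edg p X -> exists i, i \in X.
Proof. by move=> /asboolP[u [_ -> _ _]]; exact: top_ex. Qed.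

(** A linear form that is maximal over [P] at the midpoint of an edge is maximal at both ends, hence
    on the whole edge. Antipodal midpoints thus amount to opposite support faces that contain the
    edges. *)
Lemma antipodal_edges X Y : is_edg p X -> is_edg p Y ->
  antipodal_midpoints P (sub_hull p X) (sub_hull p Y) <-> compat p X Y.
Proof.
have seg0 (a b : 'rV[R]_3) : segment a b a.
  by exists 0; rewrite ?lexx ?ler01 // subr0 scale1r scale0r addr0.
have seg1 (a b : 'rV[R]_3) : segment a b b.
  by exists 1; rewrite ?lexx ?ler01 // subrr scale1r scale0r add0r.
have sub Z m u : is_midpoint (sub_hull p Z) m -> support_face P u m -> Z \subset top p u.
  move=> [a [b [Zab ->]]] [_ hm]; apply/fintype.subsetP => i iZ.
  have Pa : P a by apply: (@sub_hull_sub _ _ _ Z); rewrite Zab.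
  have Pb : P b by apply: (@sub_hull_sub _ _ _ Z); rewrite Zab.
  have := sub_hull_pt p iZ; rewrite Zab => -[t _ pE].
  have := hm a Pa; have := hm b Pb; rewrite !dotlin => h1 h2.
  have e1 : dot u b = dot u a by lra.
  apply/support_face_pt; split; first exact: hull_pt.
  by move=> y /hm; rewrite pE !dotlin e1 => h3; lra.
have mid Z : is_edg p Z -> exists m, is_midpoint (sub_hull p Z) m /\
    forall u, Z \subset top p u -> support_face P u m.
  move=> /asboolP[v [_ _ nc lZ]]; have [a [b Zab]] := edge_segment nc lZ.
  exists (2^-1 *: (a + b)); split; first by exists a, b.
  move=> u Zu; rewrite faceE; apply: sub_hull_mono Zu _.
  have -> : 2^-1 *: (a + b) = (1 - 2^-1) *: a + 2^-1 *: b.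
    by rewrite scalerDr; congr (_ *: _ + _); field.
  apply: sub_hull_convex; rewrite ?Zab //.
  by rewrite invr_ge0 ler0n invf_le1 ?ler1n.
move=> Xe Ye; split=> [[m [m' [mX mY /antipodal_supportP[u [u0 um um']]]]]|].
  by apply/asboolP; exists u; split=> //; [exact: sub mX um|exact: sub mY um'].
move=> /asboolP[u [u0 Xu Yu]]; have [m [mX mu]] := mid X Xe; have [m' [mY mu']] := mid Y Ye.
exists m, m'; split=> //; apply/antipodal_supportP; exists u; split; [|exact: mu|exact: mu'].
exact: u0.
Qed.

Lemma double_antipodal_defect : antipodal_defect P *+ 2 = double_defect p.
Proof.
rewrite /antipodal_defect /num_vertices /num_antipodal_vertex_pairs /num_antipodal_edge_pairs.
rewrite vertices_image edges_image card_image_fin; last exact: pt_inj.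
set NV := Defs.card _; set NE := Defs.card _.
have hV : NV.*2 = #|[set XY | [&& is_vtx p XY.1, is_vtx p XY.2 & compat p XY.1 XY.2]]%SET|.
  rewrite /NV (card_unordered_pairs (r := compat p) pt_inj).
  - by apply: eq_card => XY; rewrite !finset.in_set.
  - by move=> X Y; rewrite !finset.in_set; exact: antipodal_pt.
  - exact: compatC.
  - by move=> X; rewrite finset.in_set => /vtxP[i [/compat_irr]].
have hE : NE.*2 = #|[set XY | [&& is_edg p XY.1, is_edg p XY.2 & compat p XY.1 XY.2]]%SET|.
  rewrite /NE (card_unordered_pairs (r := compat p) sub_hull_inj).
  - by apply: eq_card => XY; rewrite !finset.in_set.
  - by move=> X Y; rewrite !finset.in_set; exact: antipodal_edges.
  - exact: compatC.
  - by move=> X; rewrite finset.in_set => /edgP[i /compat_irr].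
by rewrite /double_defect -hV -hE -!addnn !PoszD; ring.
Qed.

Lemma antipodal_defect_eq0 : antipodal_defect P = 0 <-> forall u, u != 0 ->
  [\/ const p (top p u), const p (top p (- u)) |
      line p (top p u) /\ line p (top p (- u))].
Proof.
rewrite -(double_defect_eq0 full i0) -double_antipodal_defect.
by split=> [->|/eqP]; rewrite ?mul0rn // mulrn_eq0 => /eqP.
Qed.

Lemma facet_not_line F v : is_facet P F -> outward_unit_normal P F v ->
  v != 0 /\ ~ line p (top p v).
Proof.
move=> [[u u0 FE] dimF] [vv [c [Fc Pc]]]; split.
  by apply/eqP => v0; move/eqP: vv; rewrite v0 dot0r eq_sym oner_eq0.
(* It is enough that [F] lies in the support face of [v], which then has two independent
   directions. *)
apply: (affine_dim2_not_line dimF) => x Fx; rewrite -faceE; split.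
  by move: Fx; rewrite FE => -[].
by move=> y /Pc; rewrite (Fc x Fx).
Qed.

Lemma opposite_face_defect : antipodal_defect P = 0 <->
  ~ exists (F : set 'rV[R]_3) v, [/\ is_facet P F, outward_unit_normal P F v
     & is_edge P (support_face P (- v)) \/ is_facet P (support_face P (- v))].
Proof.
rewrite antipodal_defect_eq0; split=> [H [F [v [Ff Fv]]]|].
  have [v0 nl] := facet_not_line Ff Fv.
  case: (H v v0) => [/const_line//|cv|[//]].
  by rewrite support_face_vtx // => -[] [_ /affine_dim_set1_eq0].
(* The condition is symmetric in [u] and [- u], so only directions that support a facet have to be
   examined. *)
move=> H; suff key u : u != 0 -> ~ line p (top p u) -> const p (top p (- u)).
  move=> u u0; have [l1|n1] := pselect (line p (top p u)); last by constructor 2; exact: key.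
  have [l2|n2] := pselect (line p (top p (- u))); first by constructor 3.
  by constructor 1; rewrite -[u]opprK; apply: key; rewrite ?oppr_eq0.
move=> u0 nl; apply/negPn/negP => nc; apply: H.
pose k := (Num.sqrt (dot u u))^-1; pose v := k *: u.
have k0 : 0 < k by rewrite invr_gt0 sqrtr_gt0 dot_gt0.
have vN : - v = k *: - u by rewrite scalerN.
have v0 : v != 0 by rewrite scaler_eq0 negb_or gt_eqF.
have topv : top p v = top p u by exact: topZ.
have topvN : top p (- v) = top p (- u) by rewrite vN; exact: topZ.
have [i iv] := top_ex p i0 v.
exists (support_face P v), v; split.
- by split; [exists v|rewrite faceE; apply: affine_dim2 => //; rewrite topv].
- split.
    rewrite dotZl dotZr mulrA -expr2 exprVn sqr_sqrtr ?dot_ge0 //.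
    by rewrite mulVf // dot_eq0.
  exists (dot v (p i)); split=> x; first by move/(support_faceP _ iv) => [].
  by move/sub_hull_setT; apply: dot_sub_hull_le => j _; exact/topP.
- have vN0 : - v != 0 by rewrite oppr_eq0.
  have [l|nl'] := pselect (line p (top p (- u))); [left|right].
    by split; [exists (- v)|rewrite faceE topvN; exact: affine_dim1].
  by split; [exists (- v)|rewrite faceE; apply: affine_dim2 => //; rewrite topvN].
Qed.

Lemma opposite_vertex_defect : antipodal_defect P = 0 <->
  forall (F : set 'rV[R]_3) v, is_facet P F -> outward_unit_normal P F v ->
    exists2 x, is_vertex P x & support_face P (- v) = [set x].
Proof.
split=> [/antipodal_defect_eq0 H F v Ff Fv|H].
  have [v0 nl] := facet_not_line Ff Fv.
  case: (H v v0) => [/const_line//|cv|[//]].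
  exists (pt (top p (- v))); last exact: support_face_vtx.
  have : [set x | is_vertex P x] (pt (top p (- v))).
    by rewrite vertices_image; exists (top p (- v)); rewrite //= finset.in_set is_vtx_top.
  by [].
apply/opposite_face_defect => -[F [v [Ff Fv]]]; have [x _ ->] := H F v Ff Fv.
by case=> -[_ /affine_dim_set1_eq0].
Qed.

End Polyhedron.

Lemma full_dim_normal_eq0 (R : realType) n (p : 'I_n -> 'rV[R]_3) :
  has_affine_dim (convex_hull p) 3 ->
  forall u, (forall i j, dot u (p i) = dot u (p j)) -> u = 0.
Proof.
move=> [x [A [Px fA PA _]]] u hu.
have [i _] := sub_hull_ex (sub_hull_setT Px).
have c y : convex_hull p y -> dot u y = dot u (p i).
  by move/sub_hull_setT; apply: dot_sub_hull => j _; exact: hu.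
apply/eqP; rewrite -trmx_eq0; apply/eqP.
have : A *m u^T = 0.
  apply/matrixP => k l; rewrite [l]ord1 mxE [RHS]mxE.
  transitivity (dot u (row k A)).
    by apply: eq_bigr => m _; rewrite !mxE mulrC.
  by apply: (addrI (dot u x)); rewrite -dotDr (c _ (PA k)) (c _ Px) addr0.
by move=> Au; rewrite -[u^T](@mulKmx _ _ _ A) -?row_free_unit // Au mulmx0.
Qed.

Unset Implicit Arguments.

Theorem corollary3p4 (R : realType) (P : set 'rV[R]_3)
    (hP : convex_polyhedron P) :
  (antipodal_defect P = 0 <->
     forall (F : set 'rV[R]_3) (n : 'rV[R]_3),
       is_facet P F -> outward_unit_normal P F n ->
       exists2 v : 'rV[R]_3, is_vertex P v & support_face P (- n) = [set v])
  /\
  (antipodal_defect P = 0 <->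
     ~ exists (F : set 'rV[R]_3) (n : 'rV[R]_3),
         [/\ is_facet P F, outward_unit_normal P F n
           & is_edge P (support_face P (- n)) \/
             is_facet P (support_face P (- n))]).
Proof.
case: hP => -[n [p ->]] dim3; have full := full_dim_normal_eq0 dim3.
have [i0 _] : exists i, i \in [set: 'I_n]%SET.
  by case: dim3 => x [_ [Px _ _ _]]; exact: sub_hull_ex (sub_hull_setT Px).
by split; [exact: opposite_vertex_defect|exact: opposite_face_defect].
Qed.
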